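(* Let $T$ be a non-abelian finite simple group and let $k$ be an integer with $5\log_2|T|<k<|T|-5\log_2|T|$. Then $\mathbb{Q}_k(T)<1/|T|$.
   Context: For a finite group $X$, let $X^\#=X\setminus\{1\}$, let $\mathscr{S}_k(X)$ be the set of $k$-element subsets of $X^\#$, and for $R\subseteq X^\#$ let $\mathrm{Aut}(X,R)$ be the setwise stabiliser of $R$ in $\mathrm{Aut}(X)$. Define $\mathbb{Q}_k(X)=|\{R\in\mathscr{S}_k(X):\mathrm{Aut}(X,R)\neq 1\}|/|\mathscr{S}_k(X)|$. *)

(* Defs.v *)
From Stdlib Require Import Reals.
From mathcomp Require Import all_boot all_fingroup all_solvable.

Set Implicit Arguments.
Unset Strict Implicit.
Unset Printing Implicit Defensive.

Local Open Scope group_scope.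

Definition Sk (gT : finGroupType) (X : {group gT}) (k : nat) : {set {set gT}} :=
  [set R : {set gT} | (R \subset X^#) && (#|R| == k)].

Definition AutXR (gT : finGroupType) (X : {group gT}) (R : {set gT})
  : {set {perm gT}} := 'N_(Aut X)(R | 'P).

Definition Qk (gT : finGroupType) (X : {group gT}) (k : nat) : R :=
  Rdiv (INR #|[set R in Sk X k | AutXR X R != 1%g]|) (INR #|Sk X k|).

Definition log2 (x : R) : R := Rdiv (ln x) (ln 2).

(* Main.v *)
(** Let n = |T| and N = n - 1. The classification of finite simple groups is
    avoided as follows. By Burnside's theorem some prime p >= 5 divides n.
    Conjugates of an element of order p generate T, and adjoining one of them to
    a subgroup that does not contain it multiplies its order by at least 5.
    Hence at most n^e automorphisms fix a subgroup H pointwise, for some e with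
    5^e |H| <= n; in particular |Aut T| <= n^d with 5^d <= n. Moreover T has no
    proper subgroup of index less than 5, so a nontrivial automorphism fixes at
    most n / 5 elements. Passing to complements, assume 2k <= N; then
    2^(k+1) > n^5.

    A permutation with f fixed points among N points leaves at most
    x^(-k) (1 + x)^f (1 + x^2)^((N - f) / 2) sets of size k invariant, for every
    x > 0. Summing over Aut T settles the case 2^(2k) >= n^(5(d + 2)), with
    x = k / (N - k), and the case n < 5^8, by finitely many numerical
    certificates: for fixed x the bound divided by C(N, k) decreases with k as
    long as k + 1 <= x (N - k).

    For n >= 5^8 and smaller k the group Aut T is too large for this. Instead,
    let s stabilise R and choose g fixed points of s in R that generate the
    subgroup H generated by all of them, with 2^g <= |H|. Once these g points are
    chosen there are only n^e possibilities for s, and R is determined by a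
    subset of H and by half of the remaining points. A large H makes e small,
    whereas a small H leaves few choices for the fixed points in R. *)

Require Import Defs.
From Stdlib Require Import Reals Lra ZArith NArith.
From mathcomp Require Import all_boot all_order all_algebra all_fingroup all_solvable.
From mathcomp Require Import integral_char Rstruct zify.

Set Implicit Arguments.
Unset Strict Implicit.
Unset Printing Implicit Defensive.
Delimit Scope R_scope with coqR.

(** * Automorphisms and subgroups of simple groups *)

Section Groups.
Local Open Scope group_scope.
Local Open Scope nat_scope.

Lemma fixed_group_set (gT : finGroupType) (T : {group gT}) (s : {perm gT}) :
  s \in Aut T -> group_set [set t in T | s t == t].
Proof.
move=> sA; apply/group_setP; split.
  by rewrite inE group1 -(autmE sA) morph1 eqxx.
move=> a b; rewrite !inE => /andP[aT /eqP ea] /andP[bT /eqP eb].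
by rewrite groupM // -(autmE sA) morphM //= ?autmE ea eb eqxx.
Qed.

Section SimpleGroup.
Variables (gT : finGroupType) (T : {group gT}).
Hypotheses (simT : simple T) (nabT : ~~ abelian T).

(** Otherwise only 2 and 3 divide |T|, so T is solvable by Burnside, and a solvable simple group has
    prime order, hence is abelian. *)
Lemma prime_divisor_ge5 : exists p, [/\ prime p, 5 <= p & p %| #|T|].
Proof.
have [/hasP[p]|/hasPn small] := boolP (has (fun p => 5 <= p) (primes #|T|)).
  by rewrite mem_primes => /and3P[pr_p _ dvp] p5; exists p.
case/negP: nabT; apply/cyclic_abelian/prime_cyclic/simple_sol_prime => //.
apply: Burnside_p_a_q_b; have -> : 2 = size [:: 2; 3] by [].
apply: uniq_leq_size; first exact: primes_uniq.
move=> p p_T; move: (small p p_T); move: p_T; rewrite mem_primes => /andP[pr_p _].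
by case: p pr_p => [|[|[|[|[|p]]]]].
Qed.

(** T acts faithfully on the cosets of H: the core of H is a proper normal subgroup, hence
    trivial. *)
Lemma card_le_index_fact (H : {group gT}) :
  H \proper T -> #|T| <= (#|T : H|)`!.
Proof.
move=> prH; have sHT := proper_sub prH.
have coreH : gcore H T = 1%g.
  have := gcore_normal sHT; case/simpleP: simT => _ /[apply] -[//|eqT].
  by have := gcore_sub H T; rewrite eqT (negPf (proper_subn prH)).
rewrite -[#|T : H|]/(#|rcosets H T|) -perm.card_Sym.
pose f t := restr_perm (rcosets H T) (actperm 'Rs t).
have actsT t : t \in T -> actperm 'Rs t \in 'N(rcosets H T | 'P).
  move=> tT; rewrite inE; apply/andP; split; first by rewrite inE.
  rewrite inE; apply/subsetP => C; rewrite inE /= apermE actpermE /=.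
  by case/rcosetsP=> y yT ->; rewrite /= rcosetE -rcosetM; apply/rcosetsP; exists (y * t)%g; rewrite ?groupM.
have injf : {in T &, injective f}.
  move=> s t sT tT eqf; apply/eqP; rewrite eq_mulgV1 -in_set1 -[[set 1%g]]coreH.
  rewrite -astabRs_rcosets; apply/astabP => C CHT.
  have /(congr1 (fun u : {perm _} => u C)) := eqf.
  rewrite /f !restr_permE ?actsT // !actpermE /= => e.
  by rewrite /= actM /= e -actM mulgV act1.
rewrite -(card_in_imset injf); apply: subset_leq_card; apply/subsetP => _ /imsetP[t tT ->].
by rewrite inE; apply: restr_perm_on.
Qed.

(* Adjoining to a proper subgroup a conjugate, not in it, of an element of
   prime order p multiplies the order by at least p. *)
Lemma card_aut_cent (H : {group gT}) : H \subset T ->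
  exists e, 5 ^ e * #|H| <= #|T| /\ #|'C_(Aut T)(H | 'P)| <= #|T| ^ e.
Proof.
have [p [pr_p p5 dvp]] := prime_divisor_ge5.
have [x xT ox] := Cauchy pr_p dvp.
have [m] := ubnP (#|T| - #|H|); elim: m H => // m IHm H ltm sHT.
have [eqHT|neHT] := eqVneq (H : {set gT}) T.
  exists 0; rewrite expn0 mul1n eqHT; split=> //; rewrite leqNgt.
  apply/negP => /card_gt1P[s [t [sC tC]]]; case/eqP; apply/permP => y.
  case/setIP: sC => sA sF; case/setIP: tC => tA tF.
  have [yT|yT] := boolP (y \in T); last by rewrite !(out_Aut _ yT).
  have := astab_act sF yT; have := astab_act tF yT.
  by rewrite /= !apermE => -> ->.
(* The conjugates of [x] generate a nontrivial normal subgroup, which is T, so they do not all lie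
   in H. *)
have [y [yT yH oy]] : exists y, [/\ y \in T, y \notin H & #[y] = p].
  have [sub|/subsetPn[y]] := boolP (x ^: T \subset H).
    have nor : <<x ^: T>> <| T.
      by rewrite /normal gen_subG class_subG //= norms_gen ?class_norm.
    case/simpleP: simT => _ /(_ [group of <<x ^: T>>] nor)[/= e1|/= eT].
      have: x \in <<x ^: T>> by rewrite mem_gen // class_refl.
      by rewrite e1 => /set1P x1; move: ox pr_p; rewrite x1 order1 => <-.
    case/negP: neHT; rewrite eqEsubset sHT /= -eT gen_subG //.
  case/imsetP=> g gT' -> ?; exists (x ^ g)%g; split=> //; first by rewrite groupJ.
  by rewrite orderJ.

pose K := (H <*> <[y]>)%G.
have sKT : K \subset T by rewrite join_subG sHT cycle_subG.
have leK : 5 * #|H| <= #|K|.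
  have tiH : H :&: <[y]> = 1%g.
    by rewrite setIC prime_TIg ?cycle_subG // -orderE oy.
  have : #|(H * <[y]>)%g| <= #|K| by apply: subset_leq_card; rewrite mul_subG ?joing_subl ?joing_subr.
  rewrite TI_cardMg // -orderE oy mulnC; apply: leq_trans.
  by rewrite leq_mul2r p5 orbT.
have H0 := cardG_gt0 H.
have leKT := subset_leq_card sKT.
have [||e [le1 le2]] := IHm K; [by lia| by [] |].
exists e.+1; split.
  by apply: leq_trans le1; rewrite expnSr -mulnA leq_mul2l leK orbT.
have -> : (#|T| ^ e.+1 = #|T| * #|T| ^ e)%N by rewrite expnS.
(* The orbit of [y] lies in T, and the stabiliser fixes H and [y], hence K, pointwise. *)
rewrite -(card_orbit_stab 'P 'C_(Aut T)(H | 'P)%G y); apply: leq_mul.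
  apply: subset_leq_card; apply/subsetP => _ /orbitP[s sC <-].
  by move: sC; rewrite inE => /andP[sA _]; rewrite /= apermE Aut_closed.
apply: leq_trans le2; apply: subset_leq_card; apply/subsetP => s.
case/setIP=> /setIP[sA sH] sy; rewrite in_setI sA /=.
have: K \subset group (fixed_group_set sA).
  rewrite join_subG cycle_subG; apply/andP; split.
    apply/subsetP => a aH; rewrite inE (subsetP sHT) //=; apply/eqP.
    by have := astab_act sH aH; rewrite /= apermE.
  by rewrite inE yT /=; apply/eqP; have /astab1P := sy; rewrite /= apermE.
move/subsetP => fixK; apply/astabP => a /fixK.
by rewrite inE => /andP[_ /eqP]; rewrite /= apermE.
Qed.
Hypothesis T_gt24 : 24 < #|T|.

(** An index of at most 4 would give |T| <= 4! = 24. *)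
Lemma proper_index_ge5 (H : {group gT}) : H \proper T -> 5 * #|H| <= #|T|.
Proof.
move=> prH; have lef := card_le_index_fact prH.
rewrite -(Lagrange (proper_sub prH)) mulnC leq_pmul2l ?cardG_gt0 //.
rewrite leqNgt; apply: contraL lef => lt5; rewrite -ltnNge.
by apply: leq_ltn_trans T_gt24; apply: (@leq_fact _ 4).
Qed.

End SimpleGroup.

End Groups.

(** * Sets invariant under a permutation *)

Section Permutations.
Local Open Scope nat_scope.

(** A cycle of length s lies in a stable set or misses it, so its weight is a^s + b^s. For s >= 2
    this is at most the weight of s / 2 transpositions; squaring avoids the root. *)
Lemma sum_squares_expn (a b s : nat) :
  2 <= s -> (b ^ s + a ^ s) ^ 2 <= (a ^ 2 + b ^ 2) ^ s.
Proof.
case: s => [//|[//|s]] _; elim: s => [|s]; first by rewrite addnC.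
move: s.+2 => {}s IHs.
apply: leq_trans (_ : (b ^ s + a ^ s) ^ 2 * (a ^ 2 + b ^ 2) <= _).
  rewrite !expnS; set P := b ^ s; set Q := a ^ s; rewrite !expn0 !muln1.
  by have := nat_Cauchy (a * P) (b * Q); nia.
by rewrite [X in _ <= X]expnSr leq_mul2r IHs orbT.
Qed.

Section Permutation.
Variables (aT : finType) (s : {perm aT}).
Implicit Types (A R U : {set aT}) (x : aT).

Definition stable A := s @: A == A.

Lemma stable_mem A x : stable A -> (s x \in A) = (x \in A).
Proof. by move/eqP => eA; rewrite -{1}eA mem_imset //; apply: perm_inj. Qed.

Lemma stable_mem_iter A x i : stable A -> ((s ^+ i)%g x \in A) = (x \in A).
Proof.
move=> sA; elim: i => [|i IHi]; first by rewrite expg0 perm1.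
by rewrite expgSr permM stable_mem.
Qed.

Lemma stable_porbit A x : stable A -> x \in A -> porbit s x \subset A.
Proof.
by move=> sA xA; apply/subsetP => _ /porbitP[i ->]; rewrite stable_mem_iter.
Qed.

Lemma porbit_stable x : stable (porbit s x).
Proof.
rewrite /stable eqEcard card_imset ?leqnn ?andbT; last exact: perm_inj.
apply/subsetP => _ /imsetP[_ /porbitP[i ->] ->].
by rewrite -permM -expgSr mem_porbit.
Qed.

Lemma stableP A : (forall x, (s x \in A) = (x \in A)) -> stable A.
Proof.
move=> sA; rewrite /stable eqEcard card_imset ?leqnn ?andbT; last exact: perm_inj.
by apply/subsetP => _ /imsetP[x xA ->]; rewrite sA.
Qed.

Lemma stableU A B : stable A -> stable B -> stable (A :|: B).
Proof. by move=> sA sB; apply: stableP => x; rewrite !inE !stable_mem. Qed.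
Lemma stableD A B : stable A -> stable B -> stable (A :\: B).
Proof. by move=> sA sB; apply: stableP => x; rewrite !inE !stable_mem. Qed.

Lemma card_porbit_gt1 x : s x != x -> 1 < #|porbit s x|.
Proof.
move=> sx; have <- : #|[set x; s x]| = 2 by rewrite cards2 eq_sym sx.
apply: subset_leq_card; apply/subsetP => y /set2P[] ->; first exact: porbit_id.
exact: (mem_porbit s 1 x).
Qed.

Lemma card_porbit_fix x : s x = x -> porbit s x = [set x].
Proof.
move=> sx; apply/setP => y; rewrite inE; apply/porbitP/eqP => [[i ->]|->].
  by elim: i => [|i IHi]; rewrite ?expg0 ?perm1 // expgSr permM IHi.
by exists 0; rewrite expg0 perm1.
Qed.

Definition fixset A := [set x in A | s x == x].

(** The sum is the product of a^c + b^c over the cycle lengths c. A fixed point contributes a + b, a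
    longer cycle is bounded by [sum_squares_expn]. The induction removes one orbit at a time. *)
Lemma stable_weight_bound A (a b : nat) : stable A ->
  (\sum_(R : {set aT} | (R \subset A) && stable R) a ^ #|R| * b ^ (#|A| - #|R|)) ^ 2
    <= (a + b) ^ (2 * #|fixset A|) * (a ^ 2 + b ^ 2) ^ (#|A| - #|fixset A|).
Proof.
have [m] := ubnP #|A|; elim: m A => // m IHm A ltm sA.
have [A0|[x xA]] := set_0Vmem A.
  rewrite (bigD1 set0) /=; last by rewrite sub0set /stable imset0 eqxx.
  rewrite big1 ?addn0; last first.
    by move=> R /andP[/andP[]]; rewrite A0 subset0 => /eqP->; rewrite eqxx.
  have -> : fixset A = set0 by apply/setP => y; rewrite !inE A0 inE.
  by rewrite A0 cards0.
set O := porbit s x; pose A' := A :\: O.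
have sO : stable O := porbit_stable x.
have OA : O \subset A := stable_porbit sA xA.
have sA' : stable A' := stableD sA sO.
have xO : x \in O := porbit_id s x.
have cO : 0 < #|O| by apply/card_gt0P; exists x.
have cA : #|A| = #|A'| + #|O|.
  by rewrite addnC -(cardsID O A) (setIidPr OA).
have ltA' : #|A'| < m by apply: leq_trans (_ : #|A| <= _); rewrite // cA -addn1 leq_add2l.
have {IHm} := IHm A' ltA' sA'.
set S' := \sum_(R | _) _; set S := \sum_(R | _) _ => IH.
(* A stable set misses the orbit O or contains it, according to whether it contains [x]. *)
have eS : S = S' * (b ^ #|O| + a ^ #|O|).
  rewrite /S (bigID (fun R : {set aT} => x \in R)) /= addnC mulnDr; congr addn.
    rewrite /S' big_distrl /=; apply: eq_big => [R|R].
      apply/andP/andP => [[/andP[RA sR] xR]|[RA sR]].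
        split=> //; rewrite subsetD RA /=; rewrite disjoint_sym disjoints_subset.
        apply/subsetP => _ /porbitP[i ->]; by rewrite inE stable_mem_iter.
      move: RA; rewrite subsetD => /andP[RA dis]; split; first by rewrite RA.
      by apply: contraL xO => xR; rewrite (disjointFr dis xR).
    case/andP=> /andP[RA sR] xR; rewrite -mulnA -expnD; congr (_ * b ^ _).
    have RA' : R \subset A'.
      rewrite subsetD RA /=; rewrite disjoint_sym disjoints_subset.
      apply/subsetP => _ /porbitP[i ->]; by rewrite inE stable_mem_iter.
    by rewrite cA addnBAC ?subset_leq_card.
  rewrite /S' big_distrl /=.
  rewrite (reindex_onto (fun R : {set aT} => R :|: O) (fun R => R :\: O)) /=; last first.
    move=> R /andP[/andP[RA sR] xR]; apply/setP => y; rewrite !inE.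
    by have [/(subsetP (stable_porbit sR xR)) ->|] := boolP (y \in O); rewrite ?orbT ?orbF.
  have disP (R : {set aT}) : (R \subset A') -> (R :|: O) :\: O = R.
    rewrite subsetD => /andP[RA dis]; apply/setP => y; rewrite !inE.
    have [yO|] := boolP (y \in O); last by rewrite orbF.
    by rewrite (disjointFl dis yO).
  apply: eq_big => [R|R].
    apply/andP/andP => [[/andP[/andP[RA sR] xR] /eqP e]|[RA' sR]].
      have RA' : R \subset A' by rewrite -e setSD.
      by split=> //; rewrite -e stableD.
    split; last by rewrite disP.
    rewrite stableU // !inE xO orbT !andbT subUset OA andbT.
    by apply: subset_trans RA' _; apply: subsetDl.
  move=> /andP[/andP[/andP[RA sR] xR] /eqP e].
  have RA' : R \subset A' by rewrite -e setSD.
  have -> : #|R :|: O| = #|R| + #|O|.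
    rewrite cardsU; move: RA'; rewrite subsetD => /andP[_]; rewrite -setI_eq0 => /eqP->.
    by rewrite cards0 subn0.
  rewrite expnD -!mulnA; congr (_ * _); rewrite mulnC; congr (b ^ _ * _).
  by rewrite cA subnDr.
rewrite eS expnMn.
have [sx|sx] := boolP (s x == x).
  have e1 : O = [set x] := card_porbit_fix (eqP sx).
  have fA : #|fixset A| = #|fixset A'|.+1.
    rewrite (cardsD1 x (fixset A)) inE xA sx add1n; congr _.+1.
    by apply: eq_card => y; rewrite !inE e1 inE andbA.
  rewrite cA fA e1 cards1 !expn1 addn1 subSS mulnSr expnD [b + a]addnC.
  by rewrite mulnAC leq_mul2r IH orbT.
have nofix y : y \in O -> s y != y.
  case/porbitP=> i ->; apply: contra sx => /eqP e; apply/eqP.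
  by apply: (@perm_inj _ (s ^+ i)%g); rewrite -!permM -expgS expgSr permM e.
have fA : fixset A = fixset A'.
  apply/setP => y; rewrite !inE; have [yO|//] := boolP (y \in O).
  by rewrite (negPf (nofix y yO)) !andbF.
have lef : #|fixset A'| <= #|A'|.
  by apply: subset_leq_card; apply/subsetP => y; rewrite inE => /andP[].
rewrite fA cA -addnBAC // expnD mulnA; apply: leq_mul => //.
exact: sum_squares_expn (card_porbit_gt1 sx).
Qed.

Definition stable_subsets A k :=
  [set R : {set aT} | [&& R \subset A, #|R| == k & stable R]].

(** Only the terms with |R| = k of the weighted sum are kept; with x = a / b this is the square of
    the bound x^(-k) (1 + x)^f (1 + x^2)^((N - f) / 2). *)
Lemma card_stable_bound A k (a b : nat) : stable A ->
  #|stable_subsets A k| ^ 2 * a ^ (2 * k) * b ^ (2 * (#|A| - k))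
    <= (a + b) ^ (2 * #|fixset A|) * (a ^ 2 + b ^ 2) ^ (#|A| - #|fixset A|).
Proof.
move=> sA; apply: leq_trans (stable_weight_bound a b sA).
rewrite !(mulnC 2) !expnM -!expnMn leq_exp2r //.
rewrite -sum1_card !big_distrl /=.
under eq_bigl => R do rewrite inE.
rewrite [X in _ <= X](bigID (fun R : {set aT} => #|R| == k)) /=.
apply: leq_trans (leq_addr _ _).
rewrite [X in X <= _](eq_bigl (fun R : {set aT} => ((R \subset A) && stable R) && (#|R| == k))).
  by apply: leq_sum => R /andP[_ /eqP->]; rewrite mul1n.
by move=> R; rewrite -andbA; congr andb; rewrite andbC.
Qed.

Lemma subset_of_card (U M : {set aT}) j :
  U \subset M -> #|U| <= j <= #|M| ->
  exists V : {set aT}, [/\ U \subset V, V \subset M & #|V| = j].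
Proof.
move=> UM; elim: j => [|j IHj] /andP[Uj jM].
  by exists U; split=> //; apply/eqP; rewrite -leqn0.
have [eU|neU] := eqVneq #|U| j.+1; first by exists U.
have [|V [UV VM cV]] := IHj; first by rewrite (ltnW jM) andbT -ltnS ltn_neqAle neU.
have /subsetPn[x xM xV] : ~~ (M \subset V).
  by apply: contraL jM => /subset_leq_card; rewrite cV -ltnNge.
exists (x |: V); split; rewrite ?subUset ?sub1set ?xM // ?cardsU1 ?xV ?cV //.
by apply: subset_trans UV _; apply: subsetUr.
Qed.

(** Every orbit has at least two points, so a transversal has at most |M| / 2. It is enlarged to the
    exact size so that the choices of U are counted by one binomial coefficient. *)
Lemma stable_orbit_cover M : stable M -> (forall x, x \in M -> s x != x) ->
  exists U : {set aT}, [/\ U \subset M, #|U| = #|M|./2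
    & M = \bigcup_(u in U) porbit s u].
Proof.
move=> sM nofix; pose P := [set porbit s x | x in M].
have parP : partition P M.
  apply/and3P; split.
  - apply/eqP/setP => y; apply/bigcupP/idP => [[_ /imsetP[x xM ->] yx]|yM].
      by apply: (subsetP (stable_porbit sM xM)).
    by exists (porbit s y); [apply: imset_f | apply: porbit_id].
  - apply/trivIsetP => _ _ /imsetP[x xM ->] /imsetP[y yM ->] neq.
    rewrite -setI_eq0; apply: contraR neq => /set0Pn[z /setIP[zx zy]].
    move: zx zy; rewrite -!eq_porbit_mem => /eqP <- /eqP <-; exact: eqxx.
  - by apply/imsetP => -[x _ e]; have := porbit_id s x; rewrite -e inE.
have trP := transversalP parP.
have cU : 2 * #|transversal P M| <= #|M|.
  rewrite (card_transversal trP) (card_partition parP) mulnC -sum_nat_const.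
  by apply: leq_sum => _ /imsetP[x xM ->]; apply/card_porbit_gt1/nofix.
have [|V [UV VM cV]] := @subset_of_card _ M #|M|./2 (transversal_sub trP).
  by apply/andP; split; lia.
exists V; split=> //; apply/eqP; rewrite eqEsubset; apply/andP; split.
  apply/subsetP => y yM; have PO : porbit s y \in P by apply: imset_f.
  have : transversal_repr y (transversal P M) (porbit s y) \in transversal P M.
    exact: (repr_mem_transversal trP y PO).
  move=> rU; apply/bigcupP; eexists; first exact: (subsetP UV _ rU).
  rewrite porbit_sym.
  exact: (repr_mem_pblock trP y PO).
by apply/bigcupsP => u uV; apply: stable_porbit => //; apply: (subsetP VM).
Qed.
End Permutation.

End Permutations.

(** * Sets with a nontrivial stabiliser *)

Section BadSets.
Local Open Scope group_scope.
Local Open Scope nat_scope.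

Lemma setDDK (aT : finType) (A B : {set aT}) : B \subset A -> A :\: (A :\: B) = B.
Proof. by move=> BA; rewrite setDDr setDv set0U; apply/setIidPr. Qed.

Lemma leq_card_bigcup (I aT : finType) (P : pred I) (A : I -> {set aT}) :
  #|\bigcup_(i | P i) A i| <= \sum_(i | P i) #|A i|.
Proof.
elim/big_rec2: _ => [|i m B _ IH]; first by rewrite cards0.
by apply: leq_trans (leq_add (leqnn _) IH); rewrite cardsU leq_subr.
Qed.

Section Bad.
Variables (gT : finGroupType) (T : {group gT}).
Implicit Types (s : {perm gT}) (A R F : {set gT}).

Definition bad k := [set R in Sk T k | AutXR T R != 1%g].

Lemma card_nontrivial : #|T^#| = #|T|.-1.
Proof. by rewrite [#|T|](cardsD1 1%g) group1. Qed.

Lemma card_Sk k : #|Sk T k| = 'C(#|T|.-1, k).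
Proof. by rewrite -card_nontrivial -cards_draws. Qed.

Lemma Aut_stable s : s \in Aut T -> stable s T^#.
Proof.
move=> sA; rewrite /stable eqEcard card_imset ?leqnn ?andbT; last exact: perm_inj.
apply/subsetP => _ /imsetP[x /setD1P[x1 xT] ->]; rewrite in_setD1 Aut_closed // andbT.
by apply: contra x1 => /eqP e; apply/eqP/(@perm_inj _ s); rewrite e -(autmE sA) morph1.
Qed.

Lemma mem_AutXR R s : (s \in AutXR T R) = (s \in Aut T) && stable s R.
Proof.
rewrite /AutXR in_setI; case: (s \in Aut T) => //=.
apply/astabsP/idP => [sR|sR x]; last by rewrite /= apermE stable_mem.
by apply: stableP => x; have := sR x; rewrite /= apermE.
Qed.

Lemma badP k R : R \in bad k ->
  [/\ R \subset T^#, #|R| = k & exists s, [/\ s \in Aut T, s != 1%g & stable s R]].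
Proof.
rewrite !inE => /andP[/andP[RT /eqP cR] nt]; split=> //.
have /trivgPn[s] : (AutXR T R)%G != 1%G :> {set _} by [].
by rewrite /= mem_AutXR => /andP[sA sR] s1; exists s.
Qed.

(** R and its complement in [T^#] have the same stabiliser, because automorphisms preserve [T^#]. *)
Lemma card_bad_compl k : k <= #|T|.-1 -> #|bad k| = #|bad (#|T|.-1 - k)|.
Proof.
have sub j : j <= #|T|.-1 -> #|bad j| <= #|bad (#|T|.-1 - j)|.
  move=> lej; have inj : {in bad j &, injective (fun R => T^# :\: R)}.
    move=> R S /badP[RT _ _] /badP[ST _ _] /(congr1 (fun A => T^# :\: A)).
    by rewrite /= !setDDK.
  rewrite -(card_in_imset inj); apply: subset_leq_card.
  apply/subsetP => _ /imsetP[R bR ->]; have [RT cR _] := badP bR.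
  have eA : AutXR T (T^# :\: R) = AutXR T R.
    apply/setP => s; rewrite !mem_AutXR; case sA: (s \in Aut T) => //=.
    apply/idP/idP => sR; last by rewrite stableD ?Aut_stable.
    by rewrite -(setDDK RT) stableD ?Aut_stable.
  move: bR; rewrite !inE eA => /andP[_ ->]; rewrite subsetDl andbT /=.
  by rewrite cardsD (setIidPr RT) card_nontrivial cR.
move=> lek; apply/eqP; rewrite eqn_leq sub //=.
by have := sub (#|T|.-1 - k); rewrite subKn //; apply; apply: leq_subr.
Qed.

Lemma bad_union_bound k :
  #|bad k| <= \sum_(s in Aut T :\ 1%g) #|stable_subsets s T^# k|.
Proof.
apply: leq_trans (leq_card_bigcup _ _).
apply: subset_leq_card; apply/subsetP => R /badP[RT cR [s [sA s1 sR]]].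
by apply/bigcupP; exists s; rewrite ?in_setD1 ?s1 // inE RT cR eqxx.
Qed.

(** A point outside the subgroup generated so far at least doubles it; other points are dropped. *)
Lemma small_generating_subset (F : {set gT}) :
  exists F0 : {set gT}, [/\ F0 \subset F, <<F0>> = <<F>> & 2 ^ #|F0| <= #|<<F0>>|].
Proof.
have [m] := ubnP #|F|; elim: m F => // m IHm F ltm.
have [->|[x xF]] := set_0Vmem F; first by exists set0; rewrite cards0 cardG_gt0.
have [|F0 [sF0 eF0 cF0]] := IHm (F :\ x); first by move: ltm; rewrite (cardsD1 x F) xF.
have eF : <<x |: F0>> = <<F>> by apply: genDU; rewrite ?sub1set.
have sF0F : F0 \subset F := subset_trans sF0 (subsetDl _ _).
have [xF0|xF0] := boolP (x \in <<F0>>).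
  exists F0; split=> //; rewrite -eF -[RHS]joingE -joing_idr; apply/esym/joing_idPr.
  by rewrite sub1set.
exists (x |: F0); split=> //; first by rewrite subUset sub1set xF.
have nF0 : x \notin F0 by apply: contra xF0 => /mem_gen.
rewrite cardsU1 nF0 add1n expnS.
have sub : <<F0>> \subset <<x |: F0>> by rewrite genS ?subsetUr.
have pr : <<F0>> \proper <<x |: F0>>.
  by rewrite properE sub; apply: contra xF0 => /subsetP-> //; rewrite mem_gen ?setU11.
rewrite -(Lagrange sub) mulnC; apply: leq_mul => //.
by rewrite indexg_gt1; case/andP: pr.
Qed.
End Bad.

(** * Invariant sets for automorphisms of a simple group *)

Section Bounds.
Variables (gT : finGroupType) (T : {group gT}).
Hypotheses (simT : simple T) (nabT : ~~ abelian T) (T_gt24 : 24 < #|T|).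
Implicit Types (s : {perm gT}) (A R F : {set gT}).
Local Notation n := #|T|.
Local Notation N := #|T|.-1.

Lemma proper_fixed_group s (sA : s \in Aut T) : s != 1%g ->
  group (fixed_group_set sA) \proper T.
Proof.
move=> s1; rewrite properE /=; apply/andP; split.
  by apply/subsetP => x; rewrite inE => /andP[].
apply: contra s1 => /subsetP sT; apply/eqP/permP => x; rewrite perm1.
have [/sT|xT] := boolP (x \in T); last by rewrite (out_Aut sA).
by rewrite inE => /andP[_ /eqP].
Qed.

(** The fixed points in T form a proper subgroup; the successor accounts for the identity. *)
Lemma card_fixset_Aut s : s \in Aut T -> s != 1%g ->
  5 * #|fixset s T^#|.+1 <= n.
Proof.
move=> sA s1; apply: leq_trans (proper_index_ge5 simT T_gt24 (proper_fixed_group sA s1)).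
rewrite leq_mul2l /=; have -> : #|fixset s T^#|.+1 = #|1%g |: fixset s T^#|.
  by rewrite cardsU1 !inE eqxx.
apply: subset_leq_card; rewrite subUset sub1set (group1 (group (fixed_group_set sA))).
by apply/subsetP => x; rewrite !inE => /andP[/andP[_ ->] ->].
Qed.

(** The bound grows with the number of fixed points, as a^2 + b^2 <= (a + b)^2, so that number may
    be replaced by any f >= floor(n / 5) - 1, which is what n < 5 (f + 2) says. *)
Lemma card_stable_Aut s k a b f : s \in Aut T -> s != 1%g ->
  n < 5 * f.+2 -> f <= N ->
  #|stable_subsets s T^# k| ^ 2 * a ^ (2 * k) * b ^ (2 * (N - k))
    <= (a + b) ^ (2 * f) * (a ^ 2 + b ^ 2) ^ (N - f).
Proof.
move=> sA s1 ltf lef; have := card_stable_bound k a b (Aut_stable sA).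
rewrite card_nontrivial => /leq_trans; apply.
have lef' : #|fixset s T^#| <= f.
  have := leq_ltn_trans (card_fixset_Aut sA s1) ltf.
  by rewrite ltn_pmul2l // !ltnS.
rewrite -{1}(subnK lef') mulnDr expnD [X in _ <= X * _]mulnC -mulnA leq_mul2l.
apply/orP; right; have -> : N - #|fixset s T^#| = f - #|fixset s T^#| + (N - f).
  by rewrite addnC addnBA // subnK.
rewrite expnD leq_mul2r; apply/orP; right; rewrite expnM.
case: (f - _) => // m; rewrite leq_exp2r //.
by rewrite sqrnD leq_addr.
Qed.

Lemma card_Aut_bound : exists d, 5 ^ d <= n /\ #|Aut T| <= n ^ d.
Proof.
have [d [le1 le2]] := card_aut_cent simT nabT (sub1G T).
exists d; rewrite cards1 muln1 in le1; split=> //; apply: leq_trans le2.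
apply: subset_leq_card; apply/subsetP => s sA; rewrite in_setI sA /=.
by apply/astabP => x /set1P ->; rewrite /= apermE -(autmE sA) morph1.
Qed.

(** The possible sets of chosen fixed points. Each point at least doubles the generated subgroup,
    and a nontrivial automorphism fixes that subgroup pointwise; hence the last two conditions. *)
Definition generators k := [set F : {set gT} |
  [&& F \subset T^#, #|F| <= k, 2 ^ #|F| <= #|<<F>>| & 5 * #|<<F>>| <= n]].

Definition sets_fixed_in k F s := [set R in stable_subsets s T^# k |
  (F \subset R) && (fixset s R \subset <<F>>)].

(** Here j counts the points of R moved by s. R is recovered from F, its k - |F| - j other fixed
    points, which lie in [<<F>>], and j / 2 moved points whose orbits cover all moved ones. *)
Lemma card_sets_fixed_in k F s :
  s \in 'C_(Aut T)(<<F>> | 'P) -> F \subset T^# -> #|F| <= k ->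
  #|sets_fixed_in k F s|
    <= \sum_(j < (k - #|F|).+1) 'C(#|<<F>>|, k - #|F| - j) * 'C(N, j./2).
Proof.
move=> /setIP[sA sF] FT Fk.
pose D (j : 'I_(k - #|F|).+1) :=
  setX [set A : {set gT} | A \subset <<F>> & #|A| == k - #|F| - j]
       [set U : {set gT} | U \subset T^# & #|U| == j./2].
pose f (p : {set gT} * {set gT}) := F :|: p.1 :|: \bigcup_(u in p.2) porbit s u.
apply: leq_trans (_ : #|\bigcup_j [set f p | p in D j]| <= _); last first.
  apply: leq_trans (leq_card_bigcup _ _) _; apply: leq_sum => j _.
  apply: leq_trans (leq_imset_card _ _) _.
  by rewrite cardsX !cards_draws card_nontrivial.
apply: subset_leq_card; apply/subsetP => R; rewrite !inE.
case/and3P=> /and3P[RT /eqP cR sR] FR fixR.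
pose M := R :\: fixset s R.
have sfix : stable s (fixset s R).
  by apply: stableP => x; rewrite !inE stable_mem // (inj_eq perm_inj).
have [|x|U [UM cU eM]] := @stable_orbit_cover _ s M.
- exact: stableD.
- by rewrite !inE => /andP[/nandP[/negP//|//] xR]; rewrite xR.
have Ffix : F \subset fixset s R.
  apply/subsetP => x xF; rewrite inE (subsetP FR) //=.
  by have := astab_act sF (mem_gen xF); rewrite /= apermE => ->.
have fR : fixset s R \subset R by apply/subsetP => x; rewrite inE => /andP[].
have cM : #|M| + #|fixset s R| = k.
  by rewrite addnC -cR -(cardsID (fixset s R) R) (setIidPr fR).
have cF := subset_leq_card Ffix.
have cMk : #|M| < (k - #|F|).+1 by rewrite ltnS leq_subRL // -cM addnC leq_add2l.
apply/bigcupP; exists (Ordinal cMk) => //; apply/imsetP.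
exists (fixset s R :\: F, U).
  rewrite !inE /= cU eqxx andbT; apply/andP; split; last first.
    by apply: subset_trans UM _; apply: subset_trans (subsetDl _ _) RT.
  rewrite (subset_trans (subsetDl _ _) fixR) cardsD (setIidPr Ffix) /=.
  by rewrite -cM subnAC addKn.
rewrite /f /= -eM; apply/setP => x; rewrite /M !inE.
have [/(subsetP FR) -> //|_] := boolP (x \in F).
by case: (x \in R) => //=; case: (s x == x).
Qed.

(** For a bad R stabilised by s, F is a small generating set of the subgroup generated by the fixed
    points of s in R. [B g] bounds the number of sets R belonging to one F of size g, over all s. *)
Lemma bad_generator_bound k (B : nat -> nat) G :
  (forall g, 5 * 2 ^ g <= n -> g < G) ->
  (forall g h e, g <= k -> 0 < e -> 2 ^ g <= h -> 5 ^ e * h <= n ->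
     n ^ e * \sum_(j < (k - g).+1) 'C(h, k - g - j) * 'C(N, j./2) <= B g) ->
  #|bad T k| <= \sum_(g < G) 'C(N, g) * B g.
Proof.
move=> boundG boundB.
have leB F : F \in generators k ->
    \sum_(s in 'C_(Aut T)(<<F>> | 'P)) #|sets_fixed_in k F s| <= B #|F|.
  rewrite inE => /and4P[FT Fk F2 F5].
  have sFT : <<F>> \subset T by rewrite gen_subG (subset_trans FT) ?subsetDl.
  (* An exponent 0 is raised to 1, which [F5] permits. *)
  have [e [e0 le1 le2]] : exists e, [/\ 0 < e, 5 ^ e * #|<<F>>| <= n
      & #|'C_(Aut T)(<<F>> | 'P)| <= n ^ e].
    have [[|e] [le1 le2]] := card_aut_cent simT nabT (H := [group of <<F>>]) sFT.
      exists 1; split=> //; apply: leq_trans le2 _.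
      by rewrite expn0 expn1 cardG_gt0.
    by exists e.+1.
  apply: leq_trans (boundB #|F| #|<<F>>| e Fk e0 F2 le1).
  apply: leq_trans (_ : \sum_(s in 'C_(Aut T)(<<F>> | 'P))
      \sum_(j < (k - #|F|).+1) 'C(#|<<F>>|, k - #|F| - j) * 'C(N, j./2) <= _).
    by apply: leq_sum => s sC; apply: card_sets_fixed_in.
  by rewrite sum_nat_const leq_mul2r le2 orbT.
apply: leq_trans (_ : \sum_(F in generators k) B #|F| <= _); last first.
  rewrite (eq_bigl (fun F => (F \in generators k) && (#|F| < G))); last first.
    move=> F; rewrite andb_idr // inE => /and4P[_ _ F2 F5]; apply: boundG.
    by apply: leq_trans F5; rewrite leq_mul2l F2.
  case: G boundG => [|G] boundG; first by rewrite big1 // => F /andP[].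
  rewrite (partition_big (fun F => inord #|F| : 'I_G.+1) xpredT) //=.
  apply: leq_sum => g _.
  rewrite (eq_bigr (fun=> B g)); last first.
    by move=> F /andP[/andP[_ ltF] /eqP <-]; rewrite inordK.
  rewrite sum_nat_cond_const leq_mul2r; apply/orP; right.
  rewrite -card_nontrivial -cards_draws; apply: subset_leq_card; apply/subsetP => F.
  rewrite !inE => /andP[/andP[/and4P[FT _ _ _] ltF] /eqP <-].
  by rewrite FT /= inordK ?eqxx.
apply: leq_trans (_ : \sum_(F in generators k)
    \sum_(s in 'C_(Aut T)(<<F>> | 'P)) #|sets_fixed_in k F s| <= _); last first.
  by apply: leq_sum => F; apply: leB.
apply: leq_trans (_ : #|\bigcup_(F in generators k)
    \bigcup_(s in 'C_(Aut T)(<<F>> | 'P)) sets_fixed_in k F s| <= _); last first.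
  apply: leq_trans (leq_card_bigcup _ _) _; apply: leq_sum => F _.
  exact: leq_card_bigcup.
apply: subset_leq_card; apply/subsetP => R /badP[RT cR [s [sA s1 sR]]].
have [F [Ffix genF F2]] := small_generating_subset (fixset s R).
have fR : fixset s R \subset R by apply/subsetP => x; rewrite inE => /andP[].
have FT : F \subset T^# by apply: subset_trans (subset_trans Ffix fR) RT.
have Fs : <<F>> \subset group (fixed_group_set sA).
  rewrite genF gen_subG; apply/subsetP => x; rewrite !inE => /andP[xR ->].
  by have := subsetP RT x xR; rewrite in_setD1 => /andP[_ ->].
apply/bigcupP; exists F.
  rewrite inE FT F2 -{1}cR subset_leq_card ?(subset_trans Ffix fR) //=.
  apply: leq_trans (proper_index_ge5 simT T_gt24 (proper_fixed_group sA s1)).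
  by rewrite leq_mul2l subset_leq_card.
apply/bigcupP; exists s.
  rewrite in_setI sA /=; apply/astabP => x /(subsetP Fs).
  by rewrite inE /= apermE => /andP[_ /eqP].
by rewrite !inE RT cR eqxx sR (subset_trans Ffix fR) genF subset_gen.
Qed.
End Bounds.

End BadSets.

(** * The union bound over single automorphisms *)

Section UnionBound.
Local Open Scope nat_scope.

Definition stable_weight a b f N := (a + b) ^ (2 * f) * (a ^ 2 + b ^ 2) ^ (N - f).

(** Square of the union bound: n^D automorphisms with at most n / 5 - 1 fixed points in [T^#], and
    one more factor n for the target 1 / n. *)
Definition simple_cond n D k a b :=
  n ^ (2 * D.+1) * stable_weight a b (n %/ 5).-1 n.-1
    <= ('C(n.-1, k) * a ^ k * b ^ (n.-1 - k)) ^ 2.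

Lemma bin_weight_step N k a b : k < N -> b * k.+1 <= a * (N - k) ->
  'C(N, k) * a ^ k * b ^ (N - k) <= 'C(N, k.+1) * a ^ k.+1 * b ^ (N - k.+1).
Proof.
move=> ltkN le; rewrite -(leq_pmul2l (ltn0Sn k)).
rewrite [X in _ <= X]mulnA [X in _ <= X * _]mulnA mul_bin_left.
set c := 'C(N, k); set x := a ^ k.
have -> : k.+1 * (c * x * b ^ (N - k)) = b * k.+1 * (c * x * b ^ (N - k.+1)).
  by rewrite -[in LHS](subnSK ltkN) expnS !mulnA; congr (_ * _); lia.
have -> : (N - k) * c * a ^ k.+1 * b ^ (N - k.+1)
        = a * (N - k) * (c * x * b ^ (N - k.+1)).
  by rewrite expnS !mulnA; congr (_ * _); rewrite -/x; lia.
by rewrite leq_mul2r le orbT.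
Qed.

Lemma bin_weight_mono N k0 k ke a b : k0 <= k <= ke -> k <= N ->
  b * ke <= a * (N.+1 - ke) ->
  'C(N, k0) * a ^ k0 * b ^ (N - k0) <= 'C(N, k) * a ^ k * b ^ (N - k).
Proof.
move=> /andP[le1 le2] leN le; elim: k le1 le2 leN => [|k IHk] le1 le2 leN.
  by move: le1; rewrite leqn0 => /eqP->.
have [e|ne] := eqVneq k0 k.+1; first by rewrite e.
apply: leq_trans (IHk _ (ltnW le2) (ltnW leN)) _; first by rewrite -ltnS ltn_neqAle ne.
apply: bin_weight_step => //; apply: leq_trans (_ : b * ke <= _).
  by rewrite leq_mul2l le2 orbT.
by apply: leq_trans le _; rewrite leq_mul2l; apply/orP; right; lia.
Qed.

(** Each of the m - n additional points contributes a factor of at least b^2. *)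
Lemma stable_weight_mono a b n m : 10 <= n -> n <= m ->
  stable_weight a b (n %/ 5).-1 n.-1 * b ^ (2 * (m.-1 - n.-1))
    <= stable_weight a b (m %/ 5).-1 m.-1.
Proof.
move=> n10 nm; rewrite /stable_weight.
set f := (n %/ 5).-1; set f' := (m %/ 5).-1.
have lef : f <= f' by rewrite /f /f'; lia.
have leK : n.-1 - f <= m.-1 - f' by rewrite /f /f'; lia.
have -> : (a + b) ^ (2 * f') = (a + b) ^ (2 * f) * (a + b) ^ (2 * (f' - f)).
  by rewrite -expnD -mulnDr subnKC.
have -> : (a ^ 2 + b ^ 2) ^ (m.-1 - f')
        = (a ^ 2 + b ^ 2) ^ (n.-1 - f) * (a ^ 2 + b ^ 2) ^ (m.-1 - f' - (n.-1 - f)).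
  by rewrite -expnD subnKC.
have -> : m.-1 - n.-1 = (f' - f) + (m.-1 - f' - (n.-1 - f)) by rewrite /f /f'; lia.
rewrite mulnDr expnD [X in _ <= X]mulnACA; apply: leq_mul => //; apply: leq_mul.
  by case: (f' - f) => // j; rewrite leq_exp2r ?leq_addl // muln_gt0.
by rewrite expnM; case: (_ - _) => // j; rewrite leq_exp2r // leq_addl.
Qed.

(** One inequality settles a rectangle of pairs (n, k): up to powers of b, the weight is largest at
    m, the binomial coefficient smallest at n1, and the term in k smallest at k0. *)
Lemma segment_cond n1 m D k0 ke a b n k :
  10 <= n1 <= n -> n <= m -> k0 <= k <= ke -> k < n -> 0 < b -> k0 <= n1.-1 ->
  b * ke <= a * (n1 - ke) ->
  m ^ (2 * D.+1) * stable_weight a b (m %/ 5).-1 m.-1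
    <= ('C(n1.-1, k0) * a ^ k0 * b ^ (m.-1 - k0)) ^ 2 ->
  simple_cond n D k a b.
Proof.
move=> /andP[n10 n1n] nm k0kke ltkn b0 lek0 leke start.
have kN : k <= n.-1 by lia.
rewrite /simple_cond.
have /andP[k0k kke] := k0kke.
apply: leq_trans (_ : ('C(n.-1, k0) * a ^ k0 * b ^ (n.-1 - k0)) ^ 2 <= _); last first.
  rewrite leq_exp2r // (bin_weight_mono k0kke) //.
  by apply: leq_trans leke _; rewrite leq_mul2l; apply/orP; right; lia.
have bp : 0 < b ^ (2 * (m.-1 - n.-1)) by rewrite expn_gt0 b0.
rewrite -(leq_pmul2r bp) -mulnA.
apply: leq_trans (_ : m ^ (2 * D.+1) * stable_weight a b (m %/ 5).-1 m.-1 <= _).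
  apply: leq_mul; first by rewrite leq_exp2r.
  by apply: stable_weight_mono => //; lia.
apply: leq_trans start _; rewrite [2 * (m.-1 - _)]mulnC expnM -expnMn leq_exp2r //.
rewrite -!mulnA -expnD; have -> : n.-1 - k0 + (m.-1 - n.-1) = m.-1 - k0 by lia.
by apply: leq_mul => //; apply: leq_bin2l; lia.
Qed.


(** Bernoulli's inequality (1 - 1/m)^j >= 1 - j/m without denominators. *)
Lemma expn_bernoulli m j : (m - j) * m ^ j <= m.-1 ^ j * m.
Proof.
elim: j => [|j IHj]; first by rewrite subn0 expn0 muln1 mul1n.
rewrite [m.-1 ^ _]expnS -mulnA; apply: leq_trans (leq_mul (leqnn m.-1) IHj).
rewrite expnS !mulnA leq_mul2r; apply/orP; right.
by case: (leqP m j) => [|?]; nia.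
Qed.

(** Both 1 + 1/y and (1 + 1/y^2)^y are at most y / (y - 1), so the weight divided by y^(2 (f + K))
    is at most (y / (y - 1))^(2f + q). The exponent is covered by w blocks of length u, each costing
    at most 2^v. *)
Lemma stable_weight_expn y f K q u w v : 1 < y -> K <= y * q ->
  2 * f + q <= u * w -> y ^ u <= 2 ^ v * y.-1 ^ u ->
  stable_weight 1 y f (f + K) <= y ^ (2 * (f + K)) * 2 ^ (v * w).
Proof.
move=> y1 leK leE cert; rewrite /stable_weight addKn exp1n.
have y0 : 0 < y by lia.
have yp0 : 0 < y.-1 by lia.
have ep j : 0 < y ^ j by rewrite expn_gt0 y0.
set E := 2 * f + q.
rewrite -(@leq_pmul2r (y.-1 ^ E)) ?expn_gt0 ?yp0 //.
have step1 : (1 + y) ^ (2 * f) * y.-1 ^ (2 * f) <= y ^ (2 * (2 * f)).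
  rewrite -expnMn [X in _ <= X]expnM; case: (2 * f) => // j; rewrite leq_exp2r //.
  by rewrite -mulnn; nia.
(* Multiply by (y^2 - 1)^y, which Bernoulli bounds from below, and use (y^2 + 1)(y^2 - 1) <= y^4. *)
have step2 : (1 + y ^ 2) ^ y * y.-1 <= y ^ (2 * y) * y.
  rewrite -(@leq_pmul2r (y * y ^ (2 * y))) ?muln_gt0 ?y0 ?ep //.
  apply: leq_trans (_ : (1 + y ^ 2) ^ y * ((y ^ 2).-1 ^ y * y ^ 2) <= _).
    rewrite -mulnA leq_mul2l; apply/orP; right.
    apply: leq_trans (expn_bernoulli (y ^ 2) y); rewrite mulnA expnM leq_mul2r.
    by apply/orP; right; rewrite -mulnn; nia.
  rewrite mulnA -expnMn.
  apply: leq_trans (_ : (y ^ 4) ^ y * y ^ 2 <= _).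
    rewrite leq_mul2r; apply/orP; right; rewrite leq_exp2r //.
    have -> : y ^ 4 = y ^ 2 * y ^ 2 by rewrite -expnD.
    by move: (y ^ 2) (ep 2); nia.
  by rewrite -expnM -expnD -!expnS -!expnSr -expnD leq_exp2l //; lia.
have step3 : (1 + y ^ 2) ^ K * y.-1 ^ q <= y ^ (2 * K) * y ^ q.
  rewrite -(leq_pmul2r (ep (2 * (y * q - K)))).
  apply: leq_trans (_ : ((1 + y ^ 2) ^ y * y.-1) ^ q <= _).
    rewrite expnMn -expnM mulnAC leq_mul2r; apply/orP; right.
    rewrite -{2}(subnKC leK) expnD leq_mul2l; apply/orP; right.
    by rewrite expnM; case: (_ - _) => // j; rewrite leq_exp2r // leq_addl.
  apply: leq_trans (_ : (y ^ (2 * y) * y) ^ q <= _).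
    by case: (q) => // j; rewrite leq_exp2r.
  by rewrite expnMn -expnM -!expnD leq_exp2l //; nia.
have step4 : y ^ E <= 2 ^ (v * w) * y.-1 ^ E.
  rewrite -(leq_pmul2r (ep (u * w - E))) -expnD subnKC //.
  apply: leq_trans (_ : (2 ^ v * y.-1 ^ u) ^ w <= _).
    by rewrite expnM; case: (w) => // j; rewrite leq_exp2r.
  rewrite expnMn -!expnM -mulnA leq_mul2l; apply/orP; right.
  rewrite -{1}(subnKC leE) expnD leq_mul2l; apply/orP; right.
  by case: (_ - _) => // j; rewrite leq_exp2r // leq_pred.
apply: leq_trans (_ : y ^ (2 * (f + K)) * y ^ E <= _); last first.
  by rewrite -mulnA leq_mul2l step4 orbT.
rewrite [y.-1 ^ E]expnD mulnACA; apply: leq_trans (leq_mul step1 step3) _.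
by rewrite -!expnD leq_exp2l // /E; lia.
Qed.

Lemma stable_weight_exact a b f K u v v1 w V : 0 < b -> K <= u * w ->
  (a + b) ^ f <= 2 ^ v1 * b ^ f -> (a ^ 2 + b ^ 2) ^ u <= 2 ^ v * b ^ (2 * u) ->
  v1 * 2 + v * w <= 2 * V ->
  stable_weight a b f (f + K) <= b ^ (2 * (f + K)) * 2 ^ (2 * V).
Proof.
move=> b0 leK cert1 cert2 leV; rewrite /stable_weight addKn.
have ep j : 0 < b ^ j by rewrite expn_gt0 b0.
have step1 : (a + b) ^ (2 * f) <= 2 ^ (v1 * 2) * b ^ (2 * f).
  by rewrite !(mulnC 2) !expnM -expnMn leq_exp2r.
have step2 : (a ^ 2 + b ^ 2) ^ K <= 2 ^ (v * w) * b ^ (2 * K).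
  rewrite -(leq_pmul2r (ep (2 * (u * w - K)))).
  apply: leq_trans (_ : (a ^ 2 + b ^ 2) ^ (u * w) <= _).
    rewrite -{2}(subnKC leK) expnD leq_mul2l; apply/orP; right.
    by rewrite expnM; case: (_ - _) => // j; rewrite leq_exp2r // leq_addl.
  apply: leq_trans (_ : (2 ^ v * b ^ (2 * u)) ^ w <= _).
    by rewrite expnM; case: (w) => // j; rewrite leq_exp2r.
  rewrite expnMn -!expnM -[X in _ <= X]mulnA -expnD leq_mul2l; apply/orP; right.
  by rewrite -mulnDr subnKC // mulnA.
apply: leq_trans (leq_mul step1 step2) _; rewrite mulnACA -!expnD -mulnDr mulnC.
by rewrite leq_mul2l leq_exp2l // leV orbT.
Qed.

Lemma start_cond n1 m D k a b V : 0 < b -> k <= m.-1 ->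
  stable_weight a b (m %/ 5).-1 m.-1 <= b ^ (2 * m.-1) * 2 ^ (2 * V) ->
  m ^ D.+1 * (b ^ k * (2 ^ V * k`!)) <= a ^ k * n1.-1 ^_ k ->
  m ^ (2 * D.+1) * stable_weight a b (m %/ 5).-1 m.-1
    <= ('C(n1.-1, k) * a ^ k * b ^ (m.-1 - k)) ^ 2.
Proof.
move=> b0 km leW start0.
have start : m ^ D.+1 * b ^ k * 2 ^ V <= a ^ k * 'C(n1.-1, k).
  by move: start0; rewrite -bin_ffact !mulnA leq_pmul2r ?fact_gt0.
apply: leq_trans (leq_mul (leqnn _) leW) _; rewrite !(mulnC 2) !expnM -!expnMn.
rewrite leq_exp2r // -{1}(subnKC km) expnD.
rewrite (_ : _ * _ = m ^ D.+1 * b ^ k * 2 ^ V * b ^ (m.-1 - k)); last by lia.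
by rewrite leq_mul2r ['C(_, _) * _]mulnC start orbT.
Qed.

(** The term at k is the largest of the N + 1 terms in the expansion of (k + (N - k))^N. *)
Lemma bin_entropy N k : k <= N ->
  N ^ N <= N.+1 * ('C(N, k) * k ^ k * (N - k) ^ (N - k)).
Proof.
move=> kN; set r := N - k.
have max j : j <= N -> 'C(N, j) * k ^ j * r ^ (N - j) <= 'C(N, k) * k ^ k * r ^ r.
  move=> jN; have [jk|kj] := leqP j k.
    apply: (@bin_weight_mono _ _ _ k) => //; first by rewrite jk leqnn.
    by rewrite mulnC leq_mul2l subSn // leqnSn orbT.
  (* Beyond k the terms are compared through N - j, with k and r exchanged. *)
  have := @bin_weight_mono N (N - j) r r r k.
  rewrite !bin_sub // /r !subKn // -/r ![_ * r ^ _ * _]mulnAC; apply.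
  - by rewrite leqnn andbT leq_sub2l // ltnW.
  - exact: leq_subr.
  - by rewrite mulnC leq_mul2l; apply/orP; right; rewrite /r; lia.
rewrite -{1}(subnK kN) expnDn -/r -[X in _ <= X * _](card_ord N.+1) -sum_nat_const.
apply: leq_sum => j _; rewrite [r ^ _ * _]mulnC mulnA.
by apply: max; rewrite -ltnS.
Qed.

(** The expansions of (1 + 1)^k and (1 + k/r)^r are compared term by term, by C(k, j) <= C(r, j)
    (k/r)^j. *)
Lemma expn_two_le r k : k <= r -> 2 ^ k * r ^ r <= (r + k) ^ r.
Proof.
move=> kr; have ffact_le j : k ^_ j * r ^ j <= r ^_ j * k ^ j.
  elim: j => [|j IHj]; first by rewrite !ffactn0.
  rewrite !ffactnSr !expnSr mulnACA [X in _ <= X]mulnACA; apply: leq_mul => //.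
  by case: (leqP j k) => ?; nia.
have bin_le j : 'C(k, j) * r ^ j <= 'C(r, j) * k ^ j.
  rewrite -(@leq_pmul2r j`!) ?fact_gt0 // mulnAC bin_ffact.
  by rewrite [X in _ <= X]mulnAC bin_ffact.
rewrite -{1}[2]/(1 + 1) !expnDn.
rewrite -(big_mkord predT (fun i => 'C(k, i) * (1 ^ (k - i) * 1 ^ i))).
rewrite -(big_mkord predT (fun i => 'C(r, i) * (r ^ (r - i) * k ^ i))) big_distrl /=.
rewrite [X in _ <= X](@big_cat_nat _ _ _ k.+1) //=.
apply: leq_trans (leq_addr _ _); rewrite !big_mkord; apply: leq_sum => i _.
have ir : i <= r by apply: leq_trans kr; rewrite -ltnS.
rewrite !exp1n !muln1 -{2}(subnK ir) expnD mulnCA [X in _ <= X]mulnCA leq_mul2l.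
by rewrite bin_le orbT.
Qed.

(** By [bin_entropy] the right side is at least (N^N / n)^2. On the left a + b = N and a^2 + b^2 <=
    N r, which saves a factor (r / N)^(N - f). Since 5 (N - f) >= 4 r, the fifth power of this
    factor is at most 2^(-4k) by [expn_two_le]. *)
Lemma large_size_cond n D k : 10 <= n -> 0 < k -> 2 * k < n ->
  n ^ (5 * D.+2) <= 2 ^ (2 * k) -> simple_cond n D k k (n.-1 - k).
Proof.
move=> n10 k0 kn le; rewrite /simple_cond.
set N := n.-1; set r := N - k; set f := (n %/ 5).-1.
have kN : k <= N by rewrite /N; lia.
have kr : k <= r by rewrite /r /N; lia.
have N0 : 0 < N by rewrite /N; lia.
have eN : N = r + k by rewrite subnK.
have n0 : 0 < n by lia.
rewrite -(@leq_pmul2l (n ^ 2)) ?expn_gt0 ?n0 // -expnMn.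
apply: leq_trans (_ : (N ^ N) ^ 2 <= _); last first.
  by rewrite leq_exp2r // (_ : n = N.+1) ?bin_entropy // /N prednK.
rewrite /stable_weight -expnM addnC -eN mulnA -expnD.
have fN : f <= N by rewrite /f /N; lia.
have -> : N * 2 = 2 * f + 2 * (N - f) by lia.
rewrite [N ^ (_ + _)]expnD mulnCA leq_mul2l; apply/orP; right.
rewrite -(@leq_exp2r _ _ 5) // expnMn -!expnM.
set E := (N - f) * 5; have leE : 4 * r <= E by rewrite /E /r /f /N; lia.
have -> : 2 * (N - f) * 5 = E + E by rewrite /E; lia.
have le1 : n ^ ((2 + 2 * D.+1) * 5) <= 2 ^ (k * 4).
  have -> : (2 + 2 * D.+1) * 5 = 5 * D.+2 * 2 by lia.
  have -> : k * 4 = 2 * k * 2 by lia.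
  by rewrite expnM [X in _ <= X]expnM leq_exp2r.
have le2 : k ^ 2 + r ^ 2 <= N * r by rewrite eN -!mulnn; nia.
have le3 : 2 ^ (k * 4) * r ^ E <= N ^ E.
  rewrite -(subnKC leE) [r ^ _]expnD [N ^ _]expnD mulnA; apply: leq_mul; last first.
    by case: (E - _) => // j; rewrite leq_exp2r // leq_subr.
  by rewrite ![4 * r]mulnC !expnM -expnMn leq_exp2r // eN expn_two_le.
apply: leq_trans (leq_mul le1 (_ : _ <= (N * r) ^ E)) _.
  by case: (E) => // j; rewrite leq_exp2r.
by rewrite expnMn mulnCA expnD leq_mul2l le3 orbT.
Qed.

Section Simple.
Local Open Scope group_scope.
Local Open Scope nat_scope.
Variables (gT : finGroupType) (T : {group gT}).
Hypotheses (simT : simple T) (nabT : ~~ abelian T) (T_gt24 : 24 < #|T|).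
Local Notation n := #|T|.

(** From 5^d <= n < 5^(D + 1) there are at most n^D automorphisms; leaving out the identity makes
    the inequality strict. *)
Lemma simple_cond_bad D k a b : n < 5 ^ D.+1 -> 0 < a -> 0 < b -> k <= n.-1 ->
  simple_cond n D k a b -> #|bad T k| * n < 'C(n.-1, k).
Proof.
move=> nD a0 b0 kN cond; have [d [d5 cA]] := card_Aut_bound simT nabT.
have n0 : 0 < n by lia.
have leA : #|Aut T| <= n ^ D.
  apply: leq_trans cA _; rewrite leq_pexp2l // -ltnS -(@ltn_exp2l 5) //.
  exact: leq_ltn_trans d5 nD.
have C0 : 0 < 'C(n.-1, k) by rewrite bin_gt0.
have ab0 : 0 < a ^ k * b ^ (n.-1 - k) by rewrite muln_gt0 !expn_gt0 a0 b0.
have les s : s \in Aut T :\ 1%g -> n ^ D.+1 * #|stable_subsets s T^# k| <= 'C(n.-1, k).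
  rewrite in_setD1 => /andP[s1 sA]; rewrite -(leq_pmul2r ab0) -(@leq_exp2r _ _ 2) //.
  rewrite [X in _ <= X ^ 2]mulnA; apply: leq_trans cond; rewrite !expnMn -!expnM.
  rewrite -mulnA ![_ * 2]mulnC; apply: leq_mul => //; rewrite mulnA.
  apply: (card_stable_Aut simT T_gt24) => //; clear -T_gt24; lia.
have le1 : n ^ D.+1 * #|bad T k| <= #|Aut T :\ 1%g| * 'C(n.-1, k).
  apply: leq_trans (leq_mul (leqnn _) (bad_union_bound T k)) _.
  by rewrite big_distrr /= -sum_nat_const; apply: leq_sum.
have ltA : #|Aut T :\ 1%g| < n ^ D.
  by apply: leq_trans leA; rewrite (cardsD1 1%g (Aut T)) group1.
have nD0 : 0 < n ^ D by rewrite expn_gt0 n0.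
rewrite -(ltn_pmul2l nD0) [_ * n]mulnC mulnA -expnSr.
by apply: leq_ltn_trans le1 _; rewrite ltn_pmul2r.
Qed.
End Simple.

(** * Certificates in binary arithmetic *)

Section BinaryCheck.
Local Open Scope N_scope.

Fixpoint ffactN (n : N) (k : nat) : N :=
  if k is j.+1 then (n - N.of_nat j) * ffactN n j else 1.

(* A segment covers the sizes from [k] to [ke] with x = a / b, for orders between
   [n1] and [m]. If [v1 = 0] then [a = 1] and (b / (b - 1))^u <= 2^v; otherwise
   (1 + x)^f <= 2^v1 and (1 + x^2)^u <= 2^v. *)
Definition segment_ok (n1 m D k : N) (seg : N * N * N * N * N * N) : bool :=
  let: (ke, a, b, u, v, v1) := seg in
  let f := m / 5 - 1 in
  let K := m - 1 - f in
  let q := (K + b - 1) / b in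
  let E := if v1 =? 0 then 2 * f + q else K in
  let w := (E + u - 1) / u in
  let V := v1 + (v * w + 1) / 2 in
  [&& 1 <=? a, 1 <=? b, k <=? n1 - 1, b * ke <=? a * (n1 - ke),
      5 * (f + 1) <=? m, m <? 5 * (f + 2), E <=? u * w, v1 * 2 + v * w <=? 2 * V,
      if v1 =? 0 then
        [&& a =? 1, 2 <=? b, K <=? b * q &
         if 32 <=? b then (u =? 75 * (b / 16)) && (v =? 7)
         else b ^ u <=? 2 ^ v * (b - 1) ^ u]
      else ((a + b) ^ f <=? 2 ^ v1 * b ^ f)
           && ((a ^ 2 + b ^ 2) ^ u <=? 2 ^ v * b ^ (2 * u)) &
      m ^ (D + 1) * (b ^ k * (2 ^ V * ffactN k (N.to_nat k)))
        <=? a ^ k * ffactN (n1 - 1) (N.to_nat k)].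

(** The list may end once the remaining sizes reach half of m or satisfy the hypothesis of
    [large_size_cond]. *)
Fixpoint segments_ok (n1 m D k : N) segs : bool :=
  if segs is seg :: segs' then
    segment_ok n1 m D k seg && segments_ok n1 m D (seg.1.1.1.1.1 + 1) segs'
  else (m - 1 <? 2 * k) || (m ^ (5 * (D + 2)) <=? 2 ^ (2 * k)).

(* A chunk [(n2, D, k, segs)] covers the orders from [n1] to [n2 - 1]. *)
Fixpoint chunks_ok (n1 bnd : N) chunks : bool :=
  if chunks is (n2, D, k, segs) :: chunks' then
    [&& n1 <? n2, n2 <=? 5 ^ (D + 1), 2 ^ k <=? n1 ^ 5,
        segments_ok n1 (n2 - 1) D k segs & chunks_ok n2 bnd chunks']
  else bnd <=? n1.

(** Rows break at the powers of 5, where the exponent D in |Aut T| <= n^D increases. *)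
Definition chunks : seq (N * N * N * seq (N * N * N * N * N * N)) := [::
  (63, 2, 29, [:: (30, 1, 1, 50, 50, 11)]);
  (66, 2, 29, [:: (32, 6, 5, 52, 67, 14)]);
  (72, 2, 30, [:: (33, 1, 1, 57, 57, 13); (35, 6, 5, 57, 74, 15)]);
  (80, 2, 30, [:: (36, 1, 1, 64, 64, 14); (39, 6, 5, 64, 83, 16)]);
  (89, 2, 31, [:: (40, 1, 1, 71, 71, 16); (43, 4, 3, 71, 105, 20)]);
  (100, 2, 32, [:: (44, 1, 1, 80, 80, 18); (49, 4, 3, 80, 118, 23)]);
  (113, 2, 33, [:: (50, 1, 1, 90, 90, 21); (55, 4, 3, 90, 133, 26)]);
  (125, 2, 34, [:: (56, 1, 1, 100, 100, 23); (61, 3, 2, 100, 171, 31)]);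
  (138, 3, 34, [:: (53, 3, 4, 110, 71, 21); (68, 5, 4, 110, 150, 31)]);
  (159, 3, 35, [:: (55, 2, 3, 127, 68, 23); (69, 1, 1, 127, 127, 30); (78, 4, 3, 127, 188, 37)]);
  (183, 3, 36, [:: (63, 2, 3, 73, 39, 26); (86, 6, 5, 73, 94, 40); (90, 3, 2, 73, 125, 47)]);
  (221, 3, 37, [:: (68, 3, 5, 88, 40, 30); (91, 1, 1, 88, 88, 43); (97, 4, 3, 88, 130, 53)]);
  (282, 3, 38, [:: (73, 1, 2, 113, 37, 33); (98, 4, 5, 113, 81, 47); (101, 1, 1, 113, 113, 55)]);
  (423, 3, 40, [:: (70, 1, 3, 85, 13, 35); (105, 3, 5, 85, 38, 57); (109, 2, 3, 85, 46, 62)]);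
  (456, 3, 43, [:: (110, 1, 2, 91, 30, 53)]);
  (625, 3, 44, [:: (114, 1, 3, 125, 20, 52); (116, 1, 2, 125, 41, 72)]);
  (937, 4, 46, [:: (104, 1, 5, 125, 8, 49); (148, 1, 2, 125, 41, 109)]);
  (1000, 4, 49, [:: (149, 1, 4, 100, 9, 64)]);
  (1500, 4, 49, [:: (111, 1, 8, 31, 6, 0); (158, 1, 5, 31, 10, 0)]);
  (2250, 4, 52, [:: (150, 1, 9, 35, 6, 0); (167, 1, 7, 40, 9, 0)]);
  (3125, 4, 55, [:: (174, 1, 11, 29, 4, 0)]);
  (4375, 5, 58, [:: (211, 1, 13, 17, 2, 0)]);
  (6125, 5, 60, [:: (220, 1, 18, 12, 1, 0)]);
  (8575, 5, 62, [:: (228, 1, 25, 50, 3, 0)]);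
  (12005, 5, 65, [:: (237, 1, 32, 150, 7, 0)]);
  (15625, 5, 67, [:: (243, 1, 48, 225, 7, 0)]);
  (21875, 6, 69, [:: (288, 1, 48, 225, 7, 0)]);
  (30624, 6, 72, [:: (298, 1, 64, 300, 7, 0)]);
  (42873, 6, 74, [:: (307, 1, 96, 450, 7, 0)]);
  (60022, 6, 76, [:: (317, 1, 128, 600, 7, 0)]);
  (78125, 6, 79, [:: (325, 1, 176, 825, 7, 0)]);
  (101562, 7, 81, [:: (374, 1, 192, 900, 7, 0)]);
  (132030, 7, 83, [:: (382, 1, 256, 1200, 7, 0)]);
  (171639, 7, 85, [:: (391, 1, 336, 1575, 7, 0)]);
  (223130, 7, 86, [:: (399, 1, 416, 1950, 7, 0)]);
  (290069, 7, 88, [:: (408, 1, 544, 2550, 7, 0)]);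
  (390625, 7, 90, [:: (417, 1, 688, 3225, 7, 0)])].

Lemma chunks_ok_cover : chunks_ok 60 (5 ^ 8) chunks.
Proof. by vm_compute. Qed.
End BinaryCheck.

Lemma N_to_nat_pow (a b : N) : N.to_nat (a ^ b) = N.to_nat a ^ N.to_nat b.
Proof.
rewrite N2Nat.inj_pow; elim: (N.to_nat b) => [|j IHj] //=.
by rewrite IHj expnS multE.
Qed.

Lemma N_to_nat_ffact n k : N.to_nat (ffactN n k) = N.to_nat n ^_ k.
Proof.
elim: k => [|k IHk] //=.
by rewrite N2Nat.inj_mul N2Nat.inj_sub IHk Nat2N.id ffactnSr mulnC.
Qed.

Lemma N_leb_to_nat (x y : N) : (x <=? y)%num -> N.to_nat x <= N.to_nat y.
Proof. by move/N.leb_le; lia. Qed.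

(** Bernoulli gives (y / (y - 1))^j <= 16/15 for j = floor(y / 16), and (16/15)^75 <= 2^7. This
    spares the evaluation of b^u for b >= 32. *)
Lemma expn_cert_bernoulli y : 32 <= y ->
  y ^ (75 * (y %/ 16)) <= 2 ^ 7 * y.-1 ^ (75 * (y %/ 16)).
Proof.
move=> y32; set j := y %/ 16.
have jy : 16 * j <= y by rewrite /j; lia.
have le1 : y ^ j * 15 <= y.-1 ^ j * 16.
  rewrite -(@leq_pmul2r y); last by lia.
  have := expn_bernoulli y j; rewrite mulnAC => le.
  apply: leq_trans (_ : y ^ j * (16 * (y - j)) <= _).
    by rewrite -mulnA leq_mul2l; apply/orP; right; lia.
  by rewrite [_ * (16 * _)]mulnC -mulnA [X in _ <= X * _]mulnC -mulnA leq_mul2l.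
rewrite mulnC !expnM -(@leq_pmul2r (15 ^ 75)) ?expn_gt0 //.
rewrite -expnMn; apply: leq_trans (_ : (y.-1 ^ j * 16) ^ 75 <= _).
  by rewrite leq_exp2r.
rewrite expnMn -mulnA mulnCA leq_mul2l; apply/orP; right.
have /N_leb_to_nat : (16 ^ 75 <=? 2 ^ 7 * 15 ^ 75)%num by vm_compute.
by rewrite N2Nat.inj_mul !N_to_nat_pow.
Qed.

Lemma N_to_nat_pred (x : N) : N.to_nat (x - 1) = (N.to_nat x).-1.
Proof. by lia. Qed.

Lemma N_to_nat_succ (x : N) : N.to_nat (x + 1) = (N.to_nat x).+1.
Proof. by lia. Qed.

Lemma N_ltb_to_nat (x y : N) : (x <? y)%num -> N.to_nat x < N.to_nat y.
Proof. by move/N.ltb_lt; lia. Qed.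

Lemma segment_ok_sound (n1 m D k : N) seg (n j : nat) :
  segment_ok n1 m D k seg -> 10 <= N.to_nat n1 <= n -> n <= N.to_nat m ->
  N.to_nat k <= j <= N.to_nat seg.1.1.1.1.1 -> j < n ->
  exists a b, [/\ 0 < a, 0 < b & simple_cond n (N.to_nat D) j a b].
Proof.
case: seg => [[[[[ke a] b] u] v] v1]; rewrite /segment_ok; cbv beta iota zeta.
set f := (m / 5 - 1)%num; set K := (m - 1 - f)%num.
set q := ((K + b - 1) / b)%num.
set E := if _ then _ else K; set w := ((E + u - 1) / u)%num.
set V := (v1 + _)%num.
case/and5P=> /N_leb_to_nat a0 /N_leb_to_nat b0 /N_leb_to_nat kn1 /N_leb_to_nat valid.
case/and5P=> /N_leb_to_nat f1 /N_ltb_to_nat f2 /N_leb_to_nat leE /N_leb_to_nat leV.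
case/andP=> cert /N_leb_to_nat start n10 nm kjke jn.
exists (N.to_nat a), (N.to_nat b); split=> //.
(* The checks 5 (f + 1) <= m < 5 (f + 2) determine f, so binary division need not be translated. *)
have ef : (N.to_nat m %/ 5).-1 = N.to_nat f by move: f1 f2; clearbody f; lia.
have eK : (N.to_nat m).-1 = N.to_nat f + N.to_nat K.
  by move: f1; rewrite /K; clearbody f; lia.
have kn1' : N.to_nat k <= (N.to_nat n1).-1 by move: kn1; clear; lia.
apply: (@segment_cond (N.to_nat n1) (N.to_nat m) _ (N.to_nat k) (N.to_nat ke)) => //.
  by move: valid; rewrite !N2Nat.inj_mul N2Nat.inj_sub.
apply: (@start_cond _ _ _ _ _ _ (N.to_nat V)) => //.
- by move: kn1' n10 nm; clear; lia.
- rewrite ef eK; move: leE leV; rewrite N2Nat.inj_add !N2Nat.inj_mul => leE leV.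
  clearbody V w; case: (N.eqb_spec v1 0) @E cert leE leV => [v10|v10] E cert leE leV.
    case/and4P: cert => /N.eqb_eq -> /N_leb_to_nat b2 /N_leb_to_nat leK cert.
    have {}leV : N.to_nat v * N.to_nat w <= 2 * N.to_nat V.
      by move: leV; rewrite v10; clear; lia.
    apply: leq_trans (_ : N.to_nat b ^ (2 * (N.to_nat f + N.to_nat K))
      * 2 ^ (N.to_nat v * N.to_nat w) <= _); last first.
      by rewrite leq_mul2l leq_exp2l // leV orbT.
    apply: (@stable_weight_expn _ _ _ (N.to_nat q) (N.to_nat u)) => //.
    + by move: leK; rewrite N2Nat.inj_mul.
    + by move: leE; rewrite /E N2Nat.inj_add N2Nat.inj_mul.
    + move: cert; case: ifP => [/N_leb_to_nat b32 /andP[/N.eqb_eq -> /N.eqb_eq ->]|_ /N_leb_to_nat].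
        rewrite N2Nat.inj_mul; have := @expn_cert_bernoulli (N.to_nat b) b32.
        suff -> : N.to_nat b %/ 16 = N.to_nat (b / 16) by [].
        have := N.div_mod b 16 (@N.neq_succ_0 15); have := N.mod_lt b 16 (@N.neq_succ_0 15).
        by move: (b / 16)%num (b mod 16)%num => x y; clear; lia.
      by rewrite N2Nat.inj_mul !N_to_nat_pow N_to_nat_pred.
  case/andP: cert => /N_leb_to_nat cert1 /N_leb_to_nat cert2.
  apply: (@stable_weight_exact _ _ _ _ (N.to_nat u) (N.to_nat v) (N.to_nat v1) (N.to_nat w)) => //.
  + by move: cert1; rewrite N2Nat.inj_mul !N_to_nat_pow N2Nat.inj_add.
  + move: cert2; rewrite !(N2Nat.inj_mul, N_to_nat_pow, N2Nat.inj_add) //.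
- move: start; rewrite !(N2Nat.inj_mul, N_to_nat_pow, N_to_nat_ffact, N_to_nat_pred).
  by rewrite N_to_nat_succ ffactnn.
Qed.

Lemma segments_ok_sound (n1 m D k : N) segs (n j : nat) :
  segments_ok n1 m D k segs -> 10 <= N.to_nat n1 <= n -> n <= N.to_nat m ->
  N.to_nat k <= j -> 2 * j < n ->
  n ^ (5 * (N.to_nat D).+2) <= 2 ^ (2 * j) \/
  exists a b, [/\ 0 < a, 0 < b & simple_cond n (N.to_nat D) j a b].
Proof.
elim: segs k => [|seg segs IH] k; cbn [segments_ok]; move=> ok n1n nm kj jn.
  case/orP: ok => [/N_ltb_to_nat|/N_leb_to_nat]; first by lia.
  rewrite !N_to_nat_pow.
  have -> : N.to_nat (5 * (D + 2)) = 5 * (N.to_nat D).+2 by clear; lia.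
  have -> : N.to_nat (2 * k) = 2 * N.to_nat k by clear; lia.
  move=> le; left; apply: leq_trans (_ : N.to_nat m ^ (5 * (N.to_nat D).+2) <= _).
    by rewrite leq_exp2r.
  by apply: leq_trans le _; rewrite leq_exp2l // leq_mul2l.
case/andP: ok => ok1 ok2.
have [le|gt] := leqP j (N.to_nat seg.1.1.1.1.1).
  by right; apply: (segment_ok_sound ok1) => //; [rewrite kj | lia].
by apply: IH ok2 _ _ _ _ => //; lia.
Qed.

Lemma chunks_ok_sound (n1 bnd : N) cs (n j : nat) :
  chunks_ok n1 bnd cs -> 10 <= N.to_nat n1 <= n -> n < N.to_nat bnd ->
  n ^ 5 < 2 ^ j.+1 -> 2 * j < n ->
  exists2 D, n < 5 ^ D.+1 & (n ^ (5 * D.+2) <= 2 ^ (2 * j) \/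
  exists a b, [/\ 0 < a, 0 < b & simple_cond n D j a b]).
Proof.
elim: cs n1 => [|[[[n2 D] k] segs] cs IH] n1; cbn [chunks_ok]; move=> ok n1n nb nj jn.
  by move/N_leb_to_nat: ok; lia.
case/and5P: ok => /N_ltb_to_nat n12 /N_leb_to_nat n2D /N_leb_to_nat k0 oks okc.
have [lt|ge] := ltnP n (N.to_nat n2); last by apply: (IH n2) => //; lia.
exists (N.to_nat D).
  apply: leq_trans lt _; apply: leq_trans n2D _.
  by rewrite N_to_nat_pow N_to_nat_succ.
apply: (segments_ok_sound oks) => //; first by lia.
rewrite !N_to_nat_pow in k0.
have /andP[_ n1n'] := n1n.
(* The chain 2^k <= n1^5 <= n^5 < 2^(j + 1) forces k <= j. *)
rewrite -ltnS -(ltn_exp2l _ _ (isT : 1 < 2)); apply: leq_ltn_trans k0 _.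
by apply: leq_ltn_trans nj; rewrite leq_exp2r.
Qed.

Lemma medium_order_cond n j : 60 <= n < 5 ^ 8 -> n ^ 5 < 2 ^ j.+1 -> 2 * j < n ->
  exists2 D, n < 5 ^ D.+1 & (n ^ (5 * D.+2) <= 2 ^ (2 * j) \/
  exists a b, [/\ 0 < a, 0 < b & simple_cond n D j a b]).
Proof.
move=> /andP[n1 n2]; apply: (chunks_ok_sound chunks_ok_cover).
  by apply/andP; split; lia.
by rewrite N_to_nat_pow.
Qed.

End UnionBound.

(** * The bound through generators of the fixed points *)

Section LogBound.
Local Open Scope R_scope.

Lemma ln_le_mono (x y : R) : 0 < x -> x <= y -> ln x <= ln y.
Proof. by move=> x0 [lt|->]; [left; apply: ln_increasing | right]. Qed.

Lemma ln_ratio_eq (a b : positive) (p : nat) :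
  INR p * ln (IZR (Z.pos a) / IZR (Z.pos b))
    = ln (IZR (Z.pos a ^ Z.of_nat p)) - ln (IZR (Z.pos b ^ Z.of_nat p)).
Proof.
have a0 : 0 < IZR (Z.pos a) by apply: IZR_lt.
have b0 : 0 < IZR (Z.pos b) by apply: IZR_lt.
rewrite /Rdiv ln_mult ?ln_Rinv //; last exact: Rinv_0_lt_compat.
by rewrite -!pow_IZR !ln_pow //; ring.
Qed.

(** Compares logarithms of rationals by evaluating (a/b)^p <= (c/d)^q over the integers. *)
Lemma ln_ratio_le (a b c d : positive) (p q : nat) :
  Z.leb (Z.pos a ^ Z.of_nat p * Z.pos d ^ Z.of_nat q)
        (Z.pos c ^ Z.of_nat q * Z.pos b ^ Z.of_nat p) ->
  INR p * ln (IZR (Z.pos a) / IZR (Z.pos b))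
    <= INR q * ln (IZR (Z.pos c) / IZR (Z.pos d)).
Proof.
move=> /Z.leb_le le; rewrite !ln_ratio_eq.
have pos (u : positive) r : 0 < IZR (Z.pos u ^ Z.of_nat r).
  by apply: IZR_lt; apply: Z.pow_pos_nonneg; lia.
suff : ln (IZR (Z.pos a ^ Z.of_nat p)) + ln (IZR (Z.pos d ^ Z.of_nat q))
    <= ln (IZR (Z.pos c ^ Z.of_nat q)) + ln (IZR (Z.pos b ^ Z.of_nat p)) by lra.
rewrite -!ln_mult; try exact: pos.
rewrite -!mult_IZR; apply: ln_le_mono; last exact: IZR_le.
by rewrite mult_IZR; apply: Rmult_lt_0_compat; apply: pos.
Qed.

(* The constants come from [(80/7)^25 <= 2^88], [2^13 <= (6/5)^50],
   [2^58 <= 5^25] and [2^44 <= (7984/3500)^37], where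
   [3500/7984 = 7/16 * 500/499]. *)
Lemma generator_log_bound (x G s : R) (k g e : nat) :
  2 <= x -> x ^ 5 < 2 ^ k.+1 -> 2 ^ g * 5 ^ e.+1 <= x ->
  1 <= G -> G ^ 4 <= x -> 1 <= s -> s <= 500 / 499 ->
  let z := 7 / 80 * (5 / 6) ^ e in
  x ^ e.+2 * G * (s ^ k * ((/ z) ^ g * (z + 4 * z) ^ k)) <= 1.
Proof.
move=> x2 hk hg G1 Gx s1 ss z.
set l := ln 2; set lam := ln x; set b := ln (6 / 5).
have l0 : 0 < l by rewrite -ln_1; apply: ln_increasing; lra.
have p0 : 0 < (5 / 6) ^ e by apply: pow_lt; lra.
have z0 : 0 < z by apply: Rmult_lt_0_compat => //; lra.
have lx : l <= lam by apply: ln_le_mono; lra.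
have two : ln (2 / 1) = l by rewrite /l; congr ln; field.
have h1 : 5 * lam < (INR k + 1) * l.
  have := ln_increasing _ _ (pow_lt x 5 ltac:(lra)) hk.
  by rewrite !ln_pow; try lra; rewrite (S_INR k) -/lam -/l /=; lra.
have h2 : INR g * l + (INR e + 1) * ln 5 <= lam.
  have g0 : 0 < 2 ^ g by apply: pow_lt; lra.
  have e0 : 0 < 5 ^ e.+1 by apply: pow_lt; lra.
  have := ln_le_mono (Rmult_lt_0_compat _ _ g0 e0) hg.
  by rewrite ln_mult // !ln_pow; try lra; rewrite S_INR -/lam -/l.
have h3 : 4 * ln G <= lam.
  have := ln_le_mono (pow_lt G 4 ltac:(lra)) Gx.
  by rewrite ln_pow; try lra; rewrite -/lam /=; lra.
have h4 : 37 * (ln s + ln (7 / 16)) <= - 44 * l.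
  have le1 : ln s + ln (7 / 16) <= ln (3500 / 7984).
    by rewrite -ln_mult; try lra; apply: ln_le_mono; lra.
  have e2 : ln (7984 / 3500) = - ln (3500 / 7984).
    by rewrite -ln_Rinv; try lra; congr ln; field.
  have := @ln_ratio_le 2 1 7984 3500 44 37 isT.
  by rewrite two e2 /=; lra.
have h5 : 25 * ln (80 / 7) <= 88 * l.
  by have := @ln_ratio_le 80 7 2 1 25 88 isT; rewrite two /=; lra.
have h6 : 13 * l <= 50 * b.
  by have := @ln_ratio_le 2 1 6 5 13 50 isT; rewrite two -/b /=; lra.
have h7 : 58 * l <= 25 * ln 5.
  have := @ln_ratio_le 2 1 5 1 58 25 isT.
  by have -> : 5 / 1 = 5 by [field]; rewrite two /=; lra.
have lz : ln (/ z) = ln (80 / 7) + INR e * b.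
  have -> : / z = 80 / 7 * (6 / 5) ^ e.
    rewrite /z Rinv_mult -pow_inv.
    by have -> : / (5 / 6) = 6 / 5 by [field]; field.
  rewrite ln_mult; [|lra|by apply: pow_lt; lra].
  by rewrite ln_pow; [|lra].
have l5z : ln (z + 4 * z) = ln (7 / 16) - INR e * b.
  have -> : z + 4 * z = 7 / 16 * (5 / 6) ^ e by rewrite /z; field.
  rewrite ln_mult; [|lra|done]; rewrite ln_pow; last by lra.
  have -> : 5 / 6 = / (6 / 5) by field.
  by rewrite ln_Rinv; try lra; rewrite -/b; lra.
have pz : 0 < / z by apply: Rinv_0_lt_compat.
set P := x ^ e.+2 * G * _.
have x0 : 0 < x ^ e.+2 by apply: pow_lt; lra.
have s0 : 0 < s ^ k by apply: pow_lt; lra.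
have zg0 : 0 < (/ z) ^ g by apply: pow_lt.
have zk0 : 0 < (z + 4 * z) ^ k by apply: pow_lt; lra.
have P0 : 0 < P by do ![apply: Rmult_lt_0_compat => //]; lra.
have lP : ln P = (INR e + 2) * lam + ln G + INR k * (ln s + ln (7 / 16))
    + INR g * ln (80 / 7) + INR e * b * (INR g - INR k).
  have G0 : 0 < G by lra.
  have zz0 : 0 < (/ z) ^ g * (z + 4 * z) ^ k by apply: Rmult_lt_0_compat.
  rewrite /P ln_mult; [|exact: Rmult_lt_0_compat|exact: Rmult_lt_0_compat].
  rewrite [ln (_ * G)]ln_mult // [ln (s ^ k * _)]ln_mult // [ln ((/ z) ^ g * _)]ln_mult //.
  rewrite (ln_pow x) ?(ln_pow s) ?(ln_pow (/ z)) ?(ln_pow (z + 4 * z)); try lra.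
  by rewrite lz l5z !S_INR -/lam; ring.
rewrite -(exp_ln P P0) -exp_0; apply/Rlt_le/exp_increasing; rewrite lP.
set E := INR e in h2 lP *.
have E0 : 0 <= E by apply: pos_INR.
have g0 : 0 <= INR g by apply: pos_INR.
have k0 : 0 <= INR k by apply: pos_INR.
set ga := INR g * l in h2; set ka := INR k * l.
have t1 : INR k * (ln s + ln (7 / 16)) <= - 44 / 37 * ka by rewrite /ka; nra.
have t2 : INR g * ln (80 / 7) <= 88 / 25 * ga by rewrite /ga; nra.
have hka : 5 * lam - l < ka by rewrite /ka; lra.
have hga : ga <= lam - 58 / 25 * (E + 1) * l by nra.
have gk : INR g <= INR k by move: hga hka; rewrite /ga /ka; nra.
have t3 : E * b * (INR g - INR k) <= 13 / 50 * E * (ga - ka).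
  have : 0 <= E * (INR k - INR g) by apply: Rmult_le_pos; lra.
  by rewrite /ga /ka; nra.
have t4 : E * (ga - ka) <= E * (- 4 * lam + l - 58 / 25 * (E + 1) * l).
  by apply: Rmult_le_compat_l; lra.
have u1 : 0 <= E * lam by apply: Rmult_le_pos; lra.
have u2 : 0 <= E * l by apply: Rmult_le_pos; lra.
have u3 : 0 <= E * (E * l) by apply: Rmult_le_pos; lra.
(* The terms in [lam] and [E * lam] have negative coefficients: 2 + 1/4 + 88/25 < 5 * 44/37 and 1 <
   4 * 13/50. *)
by nra.
Qed.

End LogBound.

(** * Comparison of the generator count with C(N, k) *)

Section GeneratorRatio.
Import Order.TTheory GRing.Theory Num.Theory.
Local Open Scope ring_scope.

Section Ratio.
Variable F : realFieldType.

Lemma bin_le_expr (n m : nat) : ('C(n, m))%:R <= n%:R ^+ m / m`!%:R :> F.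
Proof.
rewrite ler_pdivlMr ?ltr0n ?fact_gt0 // -natrM bin_ffact -natrX ler_nat.
elim: m => [|m IHm]; first by rewrite ffactn0.
by rewrite ffactnSr expnSr leq_mul // leq_subr.
Qed.

Lemma expr_le_bin (n m : nat) : (m <= n)%N ->
  (n - m)%:R ^+ m / m`!%:R <= ('C(n, m))%:R :> F.
Proof.
move=> mn; rewrite ler_pdivrMr ?ltr0n ?fact_gt0 // -natrM bin_ffact -natrX ler_nat.
have: (forall j, j <= m -> (n - m) ^ j <= n ^_ j)%N; last by apply.
elim=> [|j IHj] jm; first by rewrite ffactn0.
rewrite ffactnSr expnSr leq_mul //; first exact/IHj/ltnW.
by rewrite leq_sub2l // ltnW.
Qed.

Lemma fact_half_le (k j : nat) : (j <= k)%N ->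
  (j`! <= k ^ (j - j./2) * (j./2)`!)%N.
Proof.
move=> jk; have le : (j./2 <= j)%N by lia.
have aux i : (j./2 + i <= k -> (j./2 + i)`! <= k ^ i * (j./2)`!)%N.
  elim: i => [|i IHi] ik; first by rewrite addn0 mul1n.
  rewrite addnS factS expnS -mulnA leq_mul //; first by rewrite -addnS.
  by apply: IHi; lia.
by have := aux (j - j./2)%N; rewrite subnKC //; apply.
Qed.

(** Turns the half-size choice into a j-th power over j!, so that the sum over j becomes a binomial
    expansion. With i = floor(j / 2) it uses j! <= k^(j - i) i!, k <= N / W^2 and 2 (j - i) >= j. *)
Lemma bin_half_le (N k j : nat) (W : F) : (j <= k)%N -> (0 < N)%N -> 1 <= W ->
  W ^+ 2 * k%:R <= N%:R ->
  ('C(N, j./2))%:R <= (N%:R / W) ^+ j / j`!%:R.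
Proof.
move=> jk N0 W1 Wk; have W0 : 0 < W by apply: lt_le_trans W1.
apply: le_trans (bin_le_expr _ _) _.
have N0' : 0 < N%:R :> F by rewrite ltr0n.
rewrite ler_pdivlMr ?ltr0n ?fact_gt0 // mulrAC ler_pdivrMr ?ltr0n ?fact_gt0 //.
apply: le_trans (_ : N%:R ^+ j./2 * (k ^ (j - j./2) * (j./2)`!)%:R <= _).
  by rewrite ler_wpM2l ?exprn_ge0 ?ler0n // ler_nat fact_half_le.
rewrite natrM mulrA ler_wpM2r ?ler0n // natrX.
apply: le_trans (_ : N%:R ^+ j./2 * (N%:R / W ^+ 2) ^+ (j - j./2) <= _).
  rewrite ler_wpM2l ?exprn_ge0 ?ler0n // lerXn2r ?nnegrE ?ler0n //.
    by rewrite divr_ge0 ?ler0n // exprn_ge0 // ltW.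
  by rewrite ler_pdivlMr ?exprn_gt0 // mulrC.
rewrite !expr_div_n -exprM mulrA -exprD subnKC; last by lia.
rewrite ler_wpM2l ?exprn_ge0 ?ler0n // lef_pV2 ?posrE ?exprn_gt0 //.
by rewrite ler_weXn2l //; lia.
Qed.

(** With c = k - g, the sum is at most (N y)^c / c!, so the left side is at most N^k / k! times C(k,
    g) y^c. A single term of (z + y)^k bounds the latter, for any z > 0, and N^k / k! is at most (N
    / (N - k))^k C(N, k). *)
Lemma generator_ratio (N k g h : nat) (W z : F) :
  (g <= k)%N -> (k < N)%N -> 1 <= W -> W ^+ 2 * k%:R <= N%:R -> 0 < z ->
  ('C(N, g) * \sum_(j < (k - g).+1) 'C(h, k - g - j) * 'C(N, j./2))%:R
    <= 'C(N, k)%:R * ((N%:R / (N - k)%:R) ^+ k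
         * (z^-1 ^+ g * (z + (h%:R / N%:R + W^-1)) ^+ k)).
Proof.
move=> gk kN W1 Wk z0; set y := _ / _ + _; set c := (k - g)%N.
have N0 : 0 < N%:R :> F by rewrite ltr0n; lia.
have Nk0 : 0 < (N - k)%:R :> F by rewrite ltr0n; lia.
have W0 : 0 < W by apply: lt_le_trans W1.
have y0 : 0 <= y by rewrite addr_ge0 ?divr_ge0 ?invr_ge0 ?ler0n // ltW.
have sum_le : (\sum_(j < c.+1) 'C(h, c - j) * 'C(N, j./2))%:R
    <= (N%:R * y) ^+ c / c`!%:R.
  have -> : N%:R * y = h%:R + N%:R / W.
    by rewrite /y mulrDr mulrCA divff ?mulr1 // gt_eqF.
  rewrite exprDn mulr_suml natr_sum; apply: ler_sum => j _.
  have jc : (j <= c)%N by rewrite -ltnS.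
  rewrite -(mulr_natr (_ * (N%:R / W) ^+ j)) natrM.
  apply: le_trans (_ : (h%:R ^+ (c - j) / (c - j)`!%:R)
      * ((N%:R / W) ^+ j / j`!%:R) <= _).
    apply: ler_pM; rewrite ?ler0n ?bin_le_expr //.
    by apply: (@bin_half_le N k) => //; lia.
  have -> : ('C(c, j))%:R = c`!%:R / (j`!%:R * (c - j)`!%:R) :> F.
    apply: (canRL (mulfK _)); first by rewrite -natrM pnatr_eq0 muln_eq0 !gtn_eqF ?fact_gt0.
    by rewrite -!natrM bin_fact.
  rewrite le_eqVlt; apply/orP; left; apply/eqP.
  have f1 : j`!%:R != 0 :> F by rewrite pnatr_eq0 gtn_eqF ?fact_gt0.
  have f2 : (c - j)`!%:R != 0 :> F by rewrite pnatr_eq0 gtn_eqF ?fact_gt0.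
  have f3 : c`!%:R != 0 :> F by rewrite pnatr_eq0 gtn_eqF ?fact_gt0.
  move: (h%:R ^+ _) ((N%:R / W) ^+ _) => A B.
  by rewrite mulf_div [(c - j)`!%:R * _]mulrC [in RHS]mulrA [RHS]mulrAC mulfK.
have bink : ('C(k, g))%:R * y ^+ c <= z^-1 ^+ g * (z + y) ^+ k.
  rewrite exprVn [X in _ <= X]mulrC ler_pdivlMr ?exprn_gt0 // -(subnKC gk) -/c.
  rewrite [X in _ <= X]exprDn (bigD1 (inord c)) //= inordK ?ltnS ?leq_addl // addnK.
  rewrite -[X in X <= _]addr0; apply: lerD.
    have -> : 'C(g + c, c) = 'C(g + c, g) by rewrite -bin_sub ?leq_addl // addnK.
    rewrite -[X in _ <= X]mulr_natr.
    rewrite le_eqVlt; apply/orP; left; apply/eqP.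
    by rewrite -mulrA mulrC [y ^+ c * _]mulrC.
  apply: sumr_ge0 => i _; rewrite mulrn_wge0 // mulr_ge0 ?exprn_ge0 //.
  exact: ltW.
rewrite natrM; apply: le_trans (ler_pM _ _ (bin_le_expr N g) sum_le) _; rewrite ?ler0n //.
apply: le_trans (_ : N%:R ^+ k / k`!%:R * (('C(k, g))%:R * y ^+ c) <= _).
  have -> : ('C(k, g))%:R = k`!%:R / (g`!%:R * c`!%:R) :> F.
    apply: (canRL (mulfK _)); first by rewrite -natrM pnatr_eq0 muln_eq0 !gtn_eqF ?fact_gt0.
    by rewrite -!natrM bin_fact.
  rewrite exprMn -[in X in _ <= X](subnKC gk) exprD -/c subnKC //.
  rewrite le_eqVlt; apply/orP; left; apply/eqP.
  have f1 : g`!%:R != 0 :> F by rewrite pnatr_eq0 gtn_eqF ?fact_gt0.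
  have f2 : c`!%:R != 0 :> F by rewrite pnatr_eq0 gtn_eqF ?fact_gt0.
  have f3 : k`!%:R != 0 :> F by rewrite pnatr_eq0 gtn_eqF ?fact_gt0.
  move: (N%:R ^+ g) (N%:R ^+ c) (y ^+ c) => A B C.
  by rewrite mulf_div [in LHS]mulrA [RHS]mulrA [X in _ = X * _]mulrA divfK // mulrAC.
rewrite [X in _ <= X]mulrA; apply: ler_pM => //.
- by rewrite divr_ge0 ?exprn_ge0 ?ler0n.
- by rewrite mulr_ge0 ?ler0n ?exprn_ge0.
rewrite expr_div_n; have Nkk : 0 < (N - k)%:R ^+ k :> F by rewrite exprn_gt0.
apply: le_trans (ler_wpM2r _ (expr_le_bin (ltnW kN))); last first.
  by rewrite divr_ge0 ?exprn_ge0 ?ler0n.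
rewrite le_eqVlt; apply/orP; left; apply/eqP.
have f3 : k`!%:R != 0 :> F by rewrite pnatr_eq0 gtn_eqF ?fact_gt0.
move: ((N - k)%:R ^+ k) Nkk (N%:R ^+ k) => A /lt0r_neq0 A0 B.
by rewrite mulf_div [k`!%:R * A]mulrC -mulf_div divff // mul1r.
Qed.
End Ratio.

End GeneratorRatio.

(** * Orders from 5^8 on *)

Section LargeOrder.
Import GRing.Theory Num.Theory.
Local Open Scope nat_scope.

Lemma INR_muln m n : INR (m * n) = (INR m * INR n)%coqR.
Proof. by rewrite !INRE natrM. Qed.
Lemma INR_expn m n : INR (m ^ n) = (INR m ^ n)%coqR.
Proof. by rewrite !INRE natrX RpowE. Qed.
Lemma INR_leq m n : m <= n -> (INR m <= INR n)%coqR.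
Proof. by move=> mn; apply: le_INR; apply/ssrnat.leP. Qed.
Lemma leq_INR m n : (INR m <= INR n)%coqR -> m <= n.
Proof. by move/INR_le/ssrnat.leP. Qed.
Lemma INR_ltn m n : m < n -> (INR m < INR n)%coqR.
Proof. by move=> mn; apply: lt_INR; apply/ssrnat.ltP. Qed.
Lemma ltn_INR m n : (INR m < INR n)%coqR -> m < n.
Proof. by move/INR_lt/ssrnat.ltP. Qed.

Lemma generator_ratio_R (N k g h : nat) (W z : R) :
  g <= k -> k < N -> (1 <= W)%coqR -> (W ^ 2 * INR k <= INR N)%coqR -> (0 < z)%coqR ->
  (INR ('C(N, g) * \sum_(j < (k - g).+1) 'C(h, k - g - j) * 'C(N, j./2))
    <= INR 'C(N, k) * ((INR N / INR (N - k)) ^ k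
         * ((/ z) ^ g * (z + (INR h / INR N + / W)) ^ k)))%coqR.
Proof.
move=> gk kN /RleP W1 Wk /RltP z0.
have {}Wk : (W ^+ 2 * k%:R <= N%:R)%R by apply/RleP; rewrite -RpowE -!INRE.
have := @generator_ratio R N k g h W z gk kN W1 Wk z0.
by rewrite -!INRE -!RpowE => /RleP.
Qed.

Local Open Scope R_scope.

Lemma size_bound_growth (d : nat) :
  (250 / 37) ^ 2 * (36 / 25) ^ (d + 7) * (35 / 6) * (INR d + 9) * (INR d + 10)
    <= 5 ^ (d + 8) - 1.
Proof.
elim: d => [|d IH]; first by rewrite /=; lra.
have d0 := pos_INR d.
rewrite S_INR !addSn -!tech_pow_Rmult.
set c := (250 / 37) ^ 2 * (36 / 25) ^ (d + 7) * (35 / 6) in IH.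
have c0 : 0 <= c.
  by rewrite /c; apply: Rmult_le_pos; [apply: Rmult_le_pos|]; [lra|apply: pow_le; lra|lra].
have -> : (250 / 37) ^ 2 * (36 / 25 * (36 / 25) ^ (d + 7)) * (35 / 6) = 36 / 25 * c.
  by rewrite /c; lra.
have step : 36 / 25 * c * (INR d + 1 + 9) * (INR d + 1 + 10)
    <= 5 * (c * (INR d + 9) * (INR d + 10)) by nra.
lra.
Qed.

(** From 2^(2k) < 5^(5 (D + 1)(D + 2)) and 5^3 <= 2^7 follows 6k <= 35 (D + 1)(D + 2), which is
    small against 5^D. *)
Lemma size_bound (n k D : nat) : (8 <= D)%N -> (5 ^ D <= n)%N -> (n < 5 ^ D.+1)%N ->
  (2 ^ (2 * k) < n ^ (5 * D.+2))%N ->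
  (250 / 37 * (6 / 5) ^ D.-1) ^ 2 * INR k <= INR n.-1.
Proof.
move=> D8 nD1 nD2 kn.
have k6 : (6 * k <= 35 * (D.+1 * D.+2))%N.
  apply: ltnW; rewrite -(@ltn_exp2l 2) //.
  have -> : (6 * k = 2 * k * 3)%N by lia.
  rewrite expnM; apply: leq_trans (_ : ((n ^ (5 * D.+2)) ^ 3 <= _)%N).
    by rewrite ltn_exp2r.
  apply: leq_trans (_ : (((5 ^ D.+1) ^ (5 * D.+2)) ^ 3 <= _)%N).
    by rewrite !leq_exp2r // ltnW.
  have -> : (35 * (D.+1 * D.+2) = 7 * (5 * (D.+1 * D.+2)))%N by lia.
  have -> : (((5 ^ D.+1) ^ (5 * D.+2)) ^ 3 = (5 ^ 3) ^ (5 * (D.+1 * D.+2)))%N.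
    by rewrite -!expnM; congr (5 ^ _)%N; lia.
  by rewrite [X in (_ <= X)%N]expnM leq_exp2r.
have [d eD] : exists d, D = (d + 8)%N by exists (D - 8)%N; rewrite subnK.
have := size_bound_growth d; rewrite -eD => growth.
have le1 : 5 ^ D - 1 <= INR n.-1.
  have n0 : (0 < n)%N by apply: leq_trans nD1; rewrite expn_gt0.
  have := INR_leq nD1; rewrite INR_expn -{1}(prednK n0) (S_INR n.-1).
  have -> : INR 5 = 5 by rewrite /=; lra.
  by lra.
apply: Rle_trans le1; apply: Rle_trans growth.
have -> : D.-1 = (d + 7)%N by rewrite eD addnS.
rewrite Rpow_mult_distr -pow_mult multE mulnC pow_mult.
have -> : (6 / 5) ^ 2 = 36 / 25 by rewrite /=; lra.
have k6R : 6 * INR k <= 35 * ((INR d + 9) * (INR d + 10)).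
  have := INR_leq k6; rewrite !INR_muln eD -!addnS !plus_INR.
  by rewrite /=; lra.
have p0 : 0 <= (250 / 37) ^ 2 * (36 / 25) ^ (d + 7).
  by apply: Rmult_le_pos; [lra | apply: pow_le; lra].
by nra.
Qed.

Lemma trunc_log_pow4 n : (5 ^ 8 <= n)%N -> ((trunc_log 2 n).+1 ^ 4 <= n)%N.
Proof.
move=> n58; have n0 : (0 < n)%N by apply: leq_trans n58; rewrite expn_gt0.
have /andP[le _] := @trunc_log_bounds 2 n isT n0; apply: leq_trans le.
(* The exponents are factored so that only 2^9 <= 5^4 and 19^2 <= 2^9 are evaluated. *)
have le18 : (2 ^ (9 * 2) <= 5 ^ (4 * 2))%N by rewrite !expnM leq_exp2r.
have base : ((9 * 2).+1 ^ (2 * 2) <= 2 ^ (9 * 2))%N by rewrite !expnM leq_exp2r.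
have: (9 * 2 <= trunc_log 2 n)%N.
  by apply: trunc_log_max; [| apply: (leq_trans le18 n58)].
elim: (trunc_log 2 n) => [//|m IH]; rewrite leq_eqVlt => /orP[/eqP <-|m18].
  exact: base.
rewrite [(2 ^ m.+1)%N]expnS; apply: leq_trans (_ : (2 * m.+1 ^ 4 <= _)%N); last first.
  by rewrite leq_mul2l IH.
by rewrite !expnS !expn0 !muln1; nia.
Qed.

(** The last factor of the left side shares the target 1 / n among the C(N, g) sets F of size g and
    the possible values of g. *)
Lemma generator_count_bound (n k D g h e : nat) :
  (5 ^ 8 <= n)%N -> (5 ^ D <= n)%N -> (n < 5 ^ D.+1)%N -> (2 * k < n)%N ->
  (n ^ 5 < 2 ^ k.+1)%N -> (2 ^ (2 * k) < n ^ (5 * D.+2))%N ->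
  (g <= k)%N -> (0 < e)%N -> (2 ^ g <= h)%N -> (5 ^ e * h <= n)%N ->
  (n ^ e * (\sum_(j < (k - g).+1) 'C(h, k - g - j) * 'C(n.-1, j./2))
     * ('C(n.-1, g) * n * (trunc_log 2 n).+1) <= 'C(n.-1, k))%N.
Proof.
move=> n58 nD1 nD2 kn hk hk2 gk e0 gh eh.
have n0 : (0 < n)%N by apply: leq_trans n58; rewrite expn_gt0.
have h0 : (0 < h)%N by apply: leq_trans gh; rewrite expn_gt0.
have D8 : (8 <= D)%N.
  by rewrite -ltnS -(@ltn_exp2l 5) //; apply: leq_ltn_trans n58 nD2.
case: e e0 eh => // e _ eh.
have eD : (e <= D.-1)%N.
  rewrite -ltnS prednK; last by lia.
  rewrite -ltnS -(@ltn_exp2l 5) //; apply: leq_ltn_trans nD2.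
  by apply: leq_trans eh; rewrite leq_pmulr.
set S := (\sum_(j < _) _)%N; set N := n.-1 in S *.
set G := (trunc_log 2 n).+1.
have n390 : 390625 <= INR n.
  have := INR_leq n58; rewrite INR_expn; have -> : INR 5 = 5 by rewrite /=; lra.
  by rewrite /=; lra.
have eN : INR n = INR N + 1 by rewrite -S_INR prednK.
set W := 250 / 37 * (6 / 5) ^ D.-1.
have WN : W ^ 2 * INR k <= INR N := size_bound D8 nD1 nD2 hk2.
have p65 : 35 / 10 <= (6 / 5) ^ D.-1.
  apply: (Rle_trans _ ((6 / 5) ^ 7)); first by rewrite /=; lra.
  by apply: Rle_pow; [lra | lia].
have W23 : 23 <= W by rewrite /W; lra.
have k0 := pos_INR k.
have kN : (k < N)%N by rewrite /N; lia.
(* W >= 23 gives W^2 >= 500; this yields N / (N - k) <= 500/499. *)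
have k500 : 500 * INR k <= INR N.
  apply: Rle_trans WN; apply: Rmult_le_compat_r => //.
  have -> : W ^ 2 = W * W by ring.
  by clearbody W; nra.
set z := 7 / 80 * (5 / 6) ^ e.
have p56 : 0 < (5 / 6) ^ e by apply: pow_lt; lra.
have z0 : 0 < z by rewrite /z; lra.
have W1 : 1 <= W by lra.
have ratio := generator_ratio_R h gk kN W1 WN z0.
have N0 : 0 < INR N by lra.
have Nk : INR (N - k) = INR N - INR k by rewrite minus_INR //; apply/ssrnat.leP/ltnW.
have G4 : INR G ^ 4 <= INR n by rewrite -INR_expn; apply/INR_leq/trunc_log_pow4.
have logb : INR n ^ e.+2 * INR G * ((INR N / INR (N - k)) ^ k
    * ((/ z) ^ g * (z + 4 * z) ^ k)) <= 1.
  apply: generator_log_bound => //.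
  - lra.
  - by have := INR_ltn hk; rewrite !INR_expn.
  - have := INR_leq (leq_trans (leq_mul (leqnn (5 ^ e.+1)) gh) eh).
    by rewrite INR_muln !INR_expn Rmult_comm; have -> : INR 5 = 5 by rewrite /=; lra.
  - by have := @INR_leq 1 G isT.
  - by rewrite Nk; apply: (Rmult_le_reg_r (INR N - INR k)); [lra | rewrite /Rdiv Rmult_assoc Rinv_l; lra].
  - by rewrite Nk; apply: (Rmult_le_reg_r (INR N - INR k)); [lra | rewrite /Rdiv Rmult_assoc Rinv_l; lra].
(* The constants add up to 202/1000 + 148/1000 = 4 * 7/80: the first is n / (5N) with n <= 1.01 N,
   the second is 37/250. *)
have y4 : INR h / INR N + / W <= 4 * z.
  have hN : INR h / INR N <= 202 / 1000 * (5 / 6) ^ e.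
    have p5 : 0 < 5 ^ e by apply: pow_lt; lra.
    have h1 : 5 * 5 ^ e * INR h <= INR n.
      have := INR_leq eh; rewrite INR_muln INR_expn.
      by have -> : INR 5 = 5 by [rewrite /=; lra]; rewrite /=; lra.
    have h2 : INR h / INR N <= 202 / 1000 * (/ 5) ^ e.
      rewrite pow_inv; apply: (Rmult_le_reg_r (INR N * (5 * 5 ^ e))); first by nra.
      have -> : INR h / INR N * (INR N * (5 * 5 ^ e)) = 5 * 5 ^ e * INR h by field; lra.
      have -> : 202 / 1000 * / 5 ^ e * (INR N * (5 * 5 ^ e)) = 101 / 100 * INR N.
        by field; lra.
      by lra.
    apply: (Rle_trans _ _ _ h2); apply: Rmult_le_compat_l; first by lra.
    by apply: pow_incr; lra.
  have hW : / W <= 148 / 1000 * (5 / 6) ^ e.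
    have -> : / W = 148 / 1000 * (5 / 6) ^ D.-1.
      rewrite /W Rinv_mult -pow_inv.
      by have -> : / (6 / 5) = 5 / 6 by [field]; field.
    apply: Rmult_le_compat_l; first by lra.
    rewrite -(subnKC eD) pow_add -[X in _ <= X]Rmult_1_r.
    apply: Rmult_le_compat_l; first by lra.
    by rewrite -(pow1 (D.-1 - e)); apply: pow_incr; lra.
  by rewrite /z; lra.
have ratio' : INR ('C(N, g) * S) <= INR 'C(N, k) * ((INR N / INR (N - k)) ^ k
    * ((/ z) ^ g * (z + 4 * z) ^ k)).
  apply: (Rle_trans _ _ _ ratio); apply: Rmult_le_compat_l; first exact: pos_INR.
  apply: Rmult_le_compat_l; first by apply: pow_le; apply: Rlt_le; apply: Rdiv_lt_0_compat; lra.
  apply: Rmult_le_compat_l.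
    by apply: pow_le; apply: Rlt_le; apply: Rinv_0_lt_compat.
  apply: pow_incr; split; last by lra.
  have := pos_INR h; have W0 : 0 < / W by apply: Rinv_0_lt_compat; lra.
  have : 0 <= INR h / INR N by apply: Rle_mult_inv_pos; [exact: pos_INR | lra].
  by lra.
apply: leq_INR.
have -> : (n ^ e.+1 * S * ('C(N, g) * n * G) = n ^ e.+2 * G * ('C(N, g) * S))%N.
  by rewrite [(n ^ e.+2)%N]expnS; lia.
rewrite INR_muln [INR (n ^ e.+2 * G)]INR_muln INR_expn.
move: logb ratio'; set A := INR n ^ e.+2 * INR G.
set Q := (INR N / INR (N - k)) ^ k * _ => logb ratio'.
have A0 : 0 <= A by apply: Rmult_le_pos; [apply: pow_le; lra | exact: pos_INR].
have C0 := pos_INR 'C(N, k).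
apply: (Rle_trans _ _ _ (Rmult_le_compat_l _ _ _ A0 ratio')).
have -> : A * (INR 'C(N, k) * Q) = INR 'C(N, k) * (A * Q) by ring.
by rewrite -[X in _ <= X]Rmult_1_r; apply: Rmult_le_compat_l.
Qed.

End LargeOrder.

(** * Conclusion *)

Section Conclusion.
Local Open Scope nat_scope.

(** Excludes orders below 60: k or n - k is at most n / 2, while 2^k and 2^(n - k) both exceed
    n^5. *)
Lemma small_order_expn n : 0 < n -> n < 60 -> 2 ^ (n %/ 2) <= n ^ 5.
Proof.
move=> n0 n60.
have /allP/(_ n) : all (fun i => N.leb (2 ^ N.of_nat (i %/ 2)) (N.of_nat i ^ 5)) (iota 1 59).
  by vm_compute.
rewrite mem_iota n0 n60 => /(_ isT) /N_leb_to_nat.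
by rewrite !N_to_nat_pow !Nat2N.id.
Qed.

Section Orders.
Local Open Scope group_scope.
Local Open Scope nat_scope.
Variables (gT : finGroupType) (T : {group gT}).
Hypotheses (simT : simple T) (nabT : ~~ abelian T).
Local Notation n := #|T|.

Lemma bad_large_size D k : 24 < n -> n < 5 ^ D.+1 -> n ^ 5 < 2 ^ k.+1 -> 2 * k < n ->
  n ^ (5 * D.+2) <= 2 ^ (2 * k) -> #|bad T k| * n < 'C(n.-1, k).
Proof.
move=> n24 nD nk kn large.
have k0 : 0 < k.
  case: k nk {kn large} => // nk; move: (leq_ltn_trans (leq_pexp2l (cardG_gt0 T) (isT : 1 <= 5)) nk).
  by rewrite !expn1; lia.
apply: (simple_cond_bad simT nabT n24 nD k0 _ _ (large_size_cond _ k0 kn large)); lia.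
Qed.

Lemma bad_large_order k : 5 ^ 8 <= n -> n ^ 5 < 2 ^ k.+1 -> 2 * k < n ->
  #|bad T k| * n < 'C(n.-1, k).
Proof.
move=> n58 nk kn; have n0 := cardG_gt0 T.
have n24 : 24 < n by apply: leq_trans n58; rewrite (expnD 5 2 6) leq_pmulr ?expn_gt0.
have /andP[nD1 nD2] := @trunc_log_bounds 5 n isT n0.
set D := trunc_log 5 n in nD1 nD2.
have [large|small] := leqP (n ^ (5 * D.+2)) (2 ^ (2 * k)).
  exact: bad_large_size nD2 nk kn large.
set G := trunc_log 2 n.
(* Dividing by G + 1 while g takes only G values makes the final inequality strict. *)
pose B g := 'C(n.-1, k) %/ ('C(n.-1, g) * n * G.+1).
have boundG g : 5 * 2 ^ g <= n -> g < G.
  by move=> le; apply: trunc_log_max => //; apply: leq_trans le; rewrite expnS leq_mul2r orbT.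
have C0 : 0 < 'C(n.-1, k) by rewrite bin_gt0; lia.
have := @bad_generator_bound _ T simT nabT n24 k B G boundG.
have Bpos g h : 2 ^ g <= h -> 5 * h <= n -> 0 < 'C(n.-1, g) * n * G.+1.
  move=> gh hn; rewrite !muln_gt0 n0 bin_gt0 !andbT.
  by have := ltn_expl g (isT : 1 < 2); lia.
move=> /(_ _) le.
have {}le : #|bad T k| <= \sum_(g < G) 'C(n.-1, g) * B g.
  apply: le => g h e gk e0 gh eh; rewrite /B leq_divRL; last first.
    apply: (Bpos g h) => //; apply: leq_trans eh; rewrite leq_mul2r.
    by rewrite -{1}(expn1 5) leq_exp2l // e0 orbT.
  exact: (@generator_count_bound n k D g h e).
have le2 : #|bad T k| * n * G.+1 <= G * 'C(n.-1, k).
  apply: leq_trans (leq_mul (leq_mul le (leqnn n)) (leqnn G.+1)) _.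
  have -> : G * 'C(n.-1, k) = \sum_(g < G) 'C(n.-1, k) by rewrite sum_nat_const card_ord.
  rewrite -mulnA big_distrl /=; apply: leq_sum => g _.
  by rewrite ['C(_, g) * _]mulnC -mulnA ['C(_, g) * (_ * _)]mulnA leq_divM.
rewrite -(@ltn_pmul2r G.+1) //; apply: leq_ltn_trans le2 _.
by rewrite mulnC ltn_pmul2l.
Qed.

Lemma bad_half k : 60 <= n -> n ^ 5 < 2 ^ k.+1 -> 2 * k < n ->
  #|bad T k| * n < 'C(n.-1, k).
Proof.
move=> n60 nk kn; have [n58|n58] := leqP (5 ^ 8) n; first exact: bad_large_order.
have n24 : 24 < n by apply: leq_trans n60.
have n6058 : 60 <= n < 5 ^ 8 by rewrite n60.
have [D nD [large|[a [b [a0 b0 cond]]]]] := medium_order_cond n6058 nk kn.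
- exact: bad_large_size nD nk kn large.
- by apply: (simple_cond_bad simT nabT n24 nD a0 b0 _ cond); lia.
Qed.
End Orders.

End Conclusion.

Theorem theorem7 (gT : finGroupType) (T : {group gT}) (k : nat) :
  simple T -> ~~ abelian T ->
  Rlt (Rmult (INR 5) (log2 (INR #|T|))) (INR k) ->
  Rlt (INR k) (Rminus (INR #|T|) (Rmult (INR 5) (log2 (INR #|T|)))) ->
  Rlt (Qk T k) (Rdiv (INR 1) (INR #|T|)).
Proof.
move=> simT nabT; set n := #|T| => hk1 hk2.
have n0 : 0 < n := cardG_gt0 T.
have nR : Rle 1 (INR n) by have := @INR_leq 1 n n0.
have ln2 : Rlt 0 (ln 2) by rewrite -ln_1; apply: ln_increasing; lra.
have l0 : Rle 0 (log2 (INR n)).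
  apply: Rle_mult_inv_pos => //; rewrite -ln_1; apply: ln_le_mono; lra.
have pow_of_log j : Rlt (Rmult (INR 5) (log2 (INR n))) (INR j) -> n ^ 5 < 2 ^ j.
  move=> lt; apply: ltn_INR; rewrite !INR_expn; apply: ln_lt_inv.
  - by apply: pow_lt; lra.
  - by apply: pow_lt; rewrite /=; lra.
  rewrite !ln_pow; [|by rewrite /=; lra|lra].
  have -> : INR 2 = 2%coqR by rewrite /=; lra.
  have -> : ln (INR n) = Rmult (log2 (INR n)) (ln 2) by rewrite /log2; field; lra.
  by rewrite -Rmult_assoc; apply: Rmult_lt_compat_r.
have kn : k < n.
  have e5 : INR 5 = 5%coqR by rewrite /=; lra.
  by apply: ltn_INR; move: hk2; rewrite e5; lra.
have p1 := pow_of_log k hk1.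
have p2 : n ^ 5 < 2 ^ (n - k).
  apply: pow_of_log; rewrite minus_INR; last by apply/ssrnat.leP/ltnW.
  by lra.
have n60 : 60 <= n.
  rewrite leqNgt; apply/negP => lt60; have := small_order_expn n0 lt60.
  have [le|le] : k <= n %/ 2 \/ n - k <= n %/ 2 by lia.
    by rewrite leqNgt; apply/negP/negPn; apply: leq_trans p1 _; rewrite leq_exp2l.
  by rewrite leqNgt; apply/negP/negPn; apply: leq_trans p2 _; rewrite leq_exp2l.
have main : #|bad T k| * n < #|Sk T k|.
  rewrite card_Sk; have [lt|ge] := ltnP (2 * k) n.
    by apply: bad_half => //; apply: leq_trans p1 _; rewrite leq_exp2l.
  have kn1 : k <= n.-1 by lia.
  (* The complement in [T^#] has n - 1 - k points, so the exponent k + 1 in [bad_half] becomes n -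
     k, as in [p2]. *)
  rewrite card_bad_compl // -bin_sub //; apply: bad_half => //; last by lia.
  by rewrite (_ : (n.-1 - k).+1 = n - k) //; lia.
have Sk0 : Rlt 0 (INR #|Sk T k|) by apply: (@INR_ltn 0); apply: leq_ltn_trans main.
rewrite /Qk -/(bad T k).
have := INR_ltn main; rewrite INR_muln => lt.
apply: (Rmult_lt_reg_r (Rmult (INR n) (INR #|Sk T k|))).
  by apply: Rmult_lt_0_compat; lra.
have -> : Rmult (Rdiv (INR #|bad T k|) (INR #|Sk T k|)) (Rmult (INR n) (INR #|Sk T k|))
  = Rmult (INR #|bad T k|) (INR n) by field; lra.
have -> : Rmult (Rdiv (INR 1) (INR n)) (Rmult (INR n) (INR #|Sk T k|)) = INR #|Sk T k|.
  by rewrite /=; field; lra.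
exact: lt.
Qed.
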